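(* If $m,n\ge 4$, then $${\rm dmg}(C_m\square C_n)\ge \max\big\{{\rm dmg}(C_m)\,|V(C_n)|,\ {\rm dmg}(C_n)\,|V(C_m)|\big\}.$$
   Context: $C_k$ denotes the cycle on $k$ vertices. The Cartesian product $G\square H$ has vertex set $V(G)\times V(H)$, with $(u,v)\sim(u',v')$ iff ($u=u'$ and $vv'\in E(H)$) or ($v=v'$ and $uu'\in E(G)$). Damage game on a graph: one cop and one robber; in round $0$ the cop chooses a vertex, then the robber does; in each later round the cop moves to an adjacent vertex or passes, then the robber moves to an adjacent vertex or passes; the robber is captured if the cop occupies the robber's vertex. A vertex $v$ is damaged if the robber occupies $v$ in some round $i\ge0$ and in round $i+1$ the uncaptured robber passes or moves to a neighbour. The damage number ${\rm dmg}(\cdot)$ is the number of distinct vertices damaged when the cop plays to minimize and the robber to maximize this number. (It is known that ${\rm dmg}(C_k)=\lfloor (k-1)/2\rfloor$.) *)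

(* Defs.v *)
(* MathComp, with boolp for deciding propositions about infinite plays. *)
From mathcomp Require Import all_boot.
From mathcomp Require Import boolp.

Set Implicit Arguments.
Unset Strict Implicit.
Unset Printing Implicit Defensive.

Record sgraph := SGraph {
  vertex :> finType;
  adj : rel vertex;
  adj_sym : symmetric adj;
  adj_irrefl : irreflexive adj }.

Section Cycle.
Variable k : nat.

(* [ordS] is the successor modulo k; the test [i != j] only matters for k = 1,
   where it removes the loop. *)
Definition cycle_adj : rel 'I_k :=
  fun i j => (i != j) && ((ordS i == j) || (ordS j == i)).

Lemma cycle_adj_sym : symmetric cycle_adj.
Proof. by move=> i j; rewrite /cycle_adj eq_sym orbC. Qed.

Lemma cycle_adj_irrefl : irreflexive cycle_adj.
Proof. by move=> i; rewrite /cycle_adj eqxx. Qed.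

Definition cycle_graph : sgraph := SGraph cycle_adj_sym cycle_adj_irrefl.
End Cycle.

Section CartesianProduct.
Variables G H : sgraph.

Definition cart_adj : rel (G * H) := fun x y =>
  ((x.1 == y.1) && adj x.2 y.2) || ((x.2 == y.2) && adj x.1 y.1).

Lemma cart_adj_sym : symmetric cart_adj.
Proof.
move=> x y; rewrite /cart_adj (eq_sym x.1) (eq_sym x.2).
by rewrite (@adj_sym G x.1) (@adj_sym H x.2).
Qed.

Lemma cart_adj_irrefl : irreflexive cart_adj.
Proof. by move=> x; rewrite /cart_adj !adj_irrefl !andbF. Qed.

Definition cart_prod : sgraph := SGraph cart_adj_sym cart_adj_irrefl.
End CartesianProduct.

Section DamageGame.
Variable G : sgraph.

Definition legal_move (u v : G) : bool := (u == v) || adj u v.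

(* The (cop, robber) positions at the end of rounds 0, ..., i - 1, in this
   order, when round i is about to be played. *)
Definition history := seq (G * G).

(* A strategy returns the vertex its player occupies after moving in the coming
   round; the robber also sees the move the cop has just made in that round. On
   the empty history it returns the freely chosen initial vertex. *)
Definition cop_strategy := history -> G.
Definition robber_strategy := history -> G -> G.

Definition cop_legal (sigma : cop_strategy) : Prop :=
  forall (h : history) (c r : G), legal_move c (sigma (rcons h (c, r))).

Definition robber_legal (tau : robber_strategy) : Prop :=
  forall (h : history) (c r c' : G), legal_move r (tau (rcons h (c, r)) c').

Section Play.
Variables (sigma : cop_strategy) (tau : robber_strategy).

Fixpoint play (i : nat) : history :=
  if i is i'.+1 then
    let h := play i' in rcons h (sigma h, tau h (sigma h))
  else [::].

Definition cop_at (i : nat) : G := sigma (play i).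
Definition robber_at (i : nat) : G := tau (play i) (cop_at i).

(* The robber has not been captured when his turn comes in round i + 1: the
   players never met at the end of rounds 0, ..., i, nor right after a cop move
   in rounds 1, ..., i + 1. The sequences [cop_at] and [robber_at] formally go
   on after a capture, but nothing that happens then counts. *)
Definition uncaptured_at_turn (i : nat) : Prop :=
  forall j, j <= i ->
    cop_at j != robber_at j /\ cop_at j.+1 != robber_at j.

Definition damaged (v : G) : Prop :=
  exists i, robber_at i = v /\ uncaptured_at_turn i.

Definition damage : nat := #|[set v | `[< damaged v >]]|.
End Play.

(* The maximum and the minimum range over infinite sets of strategies, but the
   optimised values lie in {0, ..., #|G|}, so both are taken over values. *)
Definition max_damage (sigma : cop_strategy) : nat :=
  \max_(d < #|G|.+1 |
          `[< exists tau, robber_legal tau /\ damage sigma tau = d >]) d.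

Definition dmg : nat :=
  \big[minn/#|G|]_(d < #|G|.+1 |
          `[< exists sigma, cop_legal sigma /\ max_damage sigma = d >]) d.
End DamageGame.

(* Main.v *)
(* The cop can hold the damage on C_k down to (k - 1)/2 by moving to the mirror
   image of the robber under a reflection of the cycle.

   On the torus, write D and A for the horizontal and vertical distances of the
   players when the robber is to move, L = (m - 1)/2 and Ln = (n - 1)/2. Take
   a play whose damage no continuation can increase. Within a row the robber
   can always damage L vertices, so he is done if he can reach every row.
   Otherwise A >= D at all times from then on: if A < D, he could move towards
   the cop's row and pass on one side or the other. If D >= 1 occurs, running
   straight up or straight down reaches n/2 rows, and in each of them A >= D
   forces the cop to make so long a detour that 2L vertices get damaged. If
   D = 0 forever, the robber is confined to Ln rows, which are completely
   damaged; in this case the bound needs E further vertices in other rows. They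
   are damaged beforehand: starting in the cop's row, the robber collects
   enough vertices in one row, or in two adjacent ones, while A <= D, and then
   runs away from the cop's row to the opposite side of the torus, where he
   collects as many. No window of Ln rows meets both places. *)
Require Import Defs.
From mathcomp Require Import all_boot boolp.
From Stdlib Require Import ZArith Lia Classical.

(** * Distances and sums on a cycle *)

Section Circle.
Local Open Scope Z_scope.

(** The distance from [z] to the nearest multiple of [k], hence the cycle distance of two vertices
    whose lifts differ by [z]. *)
Definition circ (k z : Z) : Z := Z.min (z mod k) (k - z mod k).

Variable k : Z.
Hypothesis k_gt1 : 1 < k.

Lemma circ_ge0 z : 0 <= circ k z.
Proof. rewrite /circ; have := Z.mod_pos_bound z k; lia. Qed.

Lemma circ_le z : 2 * circ k z <= k.
Proof. rewrite /circ; lia. Qed.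

Lemma circ_addm z i : circ k (z + i * k) = circ k z.
Proof. by rewrite /circ Z_mod_plus_full. Qed.

Lemma circ_small z : 0 <= z <= k -> circ k z = Z.min z (k - z).
Proof.
move=> zk; rewrite /circ; case: (Z.eq_dec z k) => [->|zNk].
  by rewrite Z_mod_same_full; lia.
by rewrite Z.mod_small; lia.
Qed.

Lemma circ_opp z : circ k (- z) = circ k z.
Proof.
rewrite /circ; case: (Z.eq_dec (z mod k) 0) => z0.
  by rewrite Z_mod_zero_opp_full // z0; lia.
by rewrite Z_mod_nz_opp_full //; lia.
Qed.

Lemma circ_succ z : Z.abs (circ k (z + 1) - circ k z) <= 1.
Proof.
have zb := Z.mod_pos_bound z k.
have -> : circ k (z + 1) = circ k (z mod k + 1).
  rewrite -(circ_addm (z mod k + 1) (z / k)); congr (circ k _).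
  by have := Z_div_mod_eq_full z k; lia.
by rewrite circ_small /circ; lia.
Qed.

Lemma circ_lip z e : Z.abs e <= 1 -> Z.abs (circ k (z + e) - circ k z) <= Z.abs e.
Proof.
move=> e1; have [->|[->|->]] : e = 0 \/ e = 1 \/ e = -1 by lia.
- by rewrite Z.add_0_r; lia.
- by have := circ_succ z; lia.
- have := circ_succ (z + -1); have -> : z + -1 + 1 = z by lia.
  lia.
Qed.

Lemma circ_canon z : exists t w i,
  (t = 1 \/ t = -1) /\ z = t * w + i * k /\ 0 <= w /\ 2 * w <= k.
Proof.
have zb := Z.mod_pos_bound z k; have zE := Z_div_mod_eq_full z k.
case: (Z_le_gt_dec (2 * (z mod k)) k) => h.
  by exists 1, (z mod k), (z / k); lia.
by exists (-1), (k - z mod k), (z / k + 1); lia.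
Qed.

End Circle.

Section Sums.
Local Open Scope Z_scope.

Fixpoint zsum (F : Z -> Z) (b : Z) (k : nat) : Z :=
  if k is k'.+1 then F b + zsum F (b + 1) k' else 0.

Lemma zsum_cat F b k l : zsum F b (k + l) = zsum F b k + zsum F (b + Z.of_nat k) l.
Proof.
elim: k b => [|k IH] b; first by rewrite Z.add_0_r.
have -> : b + Z.of_nat k.+1 = b + 1 + Z.of_nat k by lia.
by rewrite addSn /= IH; lia.
Qed.

Lemma zsum_le F G b k : (forall i, b <= i < b + Z.of_nat k -> F i <= G i) ->
  zsum F b k <= zsum G b k.
Proof.
elim: k b => [|k IH] b FG /=; first by lia.
have := FG b; have := IH (b + 1); move=> h1 h2.
have := h1 (fun i hi => FG i ltac:(lia)); lia.
Qed.

Lemma zsum_const c b k : zsum (fun _ => c) b k = c * Z.of_nat k.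
Proof. by elim: k b => [|k IH] b; rewrite /= ?IH; lia. Qed.

Lemma zsum_ge c F b k : (forall i, b <= i < b + Z.of_nat k -> c <= F i) ->
  c * Z.of_nat k <= zsum F b k.
Proof. by move=> cF; rewrite -(zsum_const c b); apply: zsum_le. Qed.

(** Shifting the window by one trades [F b] for [F (b + k)], which has the same value. *)
Lemma zsum_per F k : (forall z, F (z + Z.of_nat k) = F z) ->
  forall b c, zsum F b k = zsum F c k.
Proof.
move=> Fper.
have step b : zsum F b k = zsum F (b + 1) k.
  have := zsum_cat F b 1 k; have := zsum_cat F b k 1.
  by rewrite addnC => -> /=; have := Fper b; lia.
have nstep b i : zsum F b k = zsum F (b + Z.of_nat i) k.
  elim: i => [|i IH]; first by rewrite Z.add_0_r.
  by rewrite IH step; congr zsum; lia.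
move=> b c; case: (Z_le_gt_dec b c) => h.
  by rewrite (nstep b (Z.to_nat (c - b))); congr zsum; lia.
by rewrite (nstep c (Z.to_nat (b - c))); congr zsum; lia.
Qed.

Lemma zsum_ext F G b k : (forall i, F i = G i) -> zsum F b k = zsum G b k.
Proof. by move=> FG; elim: k b => [|k IH] b //=; rewrite FG IH. Qed.

End Sums.
(** * The robber's moves on the torus *)

Section Arena.
Local Open Scope Z_scope.

(* What the robber may rely on against a fixed cop strategy. A state is a play at
   whose end the robber is to move; positions are lifted to Z x Z, and only the
   moves that cannot be punished by an immediate capture are offered. *)
Record arena (m n : Z) := Arena {
  state : Type;
  rx : state -> Z;
  ry : state -> Z;
  cx : state -> Z;
  cy : state -> Z;
  hit : state -> Z -> Z -> bool;
  hit_px : forall s x y, hit s (x + m) y = hit s x y;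
  hit_py : forall s x y, hit s x (y + n) = hit s x y;
  hit_cur : forall s, hit s (rx s) (ry s);
  apart : forall s, 1 <= circ m (cx s - rx s) + circ n (cy s - ry s);
  move_ex : forall s u v, Z.abs u + Z.abs v <= 1 ->
    2 <= circ m (cx s - rx s - u) + circ n (cy s - ry s - v) ->
    exists s', [/\ rx s' = rx s + u, ry s' = ry s + v,
      Z.abs (cx s' - cx s) + Z.abs (cy s' - cy s) <= 1 &
      forall x y, hit s x y -> hit s' x y];
  start_ex : forall u v, 2 <= circ m u + circ n v ->
    exists s, Z.abs (cx s - rx s - u) + Z.abs (cy s - ry s - v) <= 1 }.

Arguments state {m n} A : rename.
Arguments rx {m n A} s : rename.
Arguments ry {m n A} s : rename.
Arguments cx {m n A} s : rename.
Arguments cy {m n A} s : rename.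
Arguments hit {m n A} s x y : rename.
Arguments hit_px {m n A} s x y : rename.
Arguments hit_py {m n A} s x y : rename.
Arguments hit_cur {m n A} s : rename.
Arguments apart {m n A} s : rename.
Arguments move_ex {m n A} s u v : rename.
Arguments start_ex {m n} A u v : rename.

Context {m n : Z} (A : arena m n).
Hypotheses (m_ge4 : 4 <= m) (n_ge4 : 4 <= n).

Implicit Types s : state A.
(* All that is retained of the fact that s' continues s. *)
Definition le s s' := forall x y, hit s x y -> hit s' x y.

Lemma le_refl s : le s s. Proof. by []. Qed.

Lemma le_trans s2 s1 s3 : le s1 s2 -> le s2 s3 -> le s1 s3.
Proof. by move=> h1 h2 x y /h1 /h2. Qed.

Lemma hit_pery s x y i : hit s x (y + i * n) = hit s x y.
Proof.
have nat_case j : forall y', hit s x (y' + Z.of_nat j * n) = hit s x y'.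
  elim: j => [|j IH] y'; first by congr hit; lia.
  by rewrite -[RHS]IH -[RHS]hit_py; congr hit; lia.
case: (Z_le_gt_dec 0 i) => i0.
  by rewrite -[RHS](nat_case (Z.to_nat i)) Z2Nat.id.
rewrite -(nat_case (Z.to_nat (- i)) (y + i * n)) Z2Nat.id; last lia.
by congr hit; lia.
Qed.

Definition row_hits s y := zsum (fun x => Z.b2z (hit s x y)) 0 (Z.to_nat m).
Definition hits s := zsum (row_hits s) 0 (Z.to_nat n).

Lemma row_hitsE b s y : row_hits s y = zsum (fun x => Z.b2z (hit s x y)) b (Z.to_nat m).
Proof.
apply: zsum_per => z; rewrite Z2Nat.id; last lia.
by rewrite hit_px.
Qed.

Lemma row_hits_per s y i : row_hits s (y + i * n) = row_hits s y.
Proof. by apply: zsum_ext => x; rewrite hit_pery. Qed.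

Lemma hitsE b s : hits s = zsum (row_hits s) b (Z.to_nat n).
Proof.
apply: zsum_per => z; rewrite Z2Nat.id; last lia.
by have := row_hits_per s z 1; rewrite Z.mul_1_l.
Qed.

Lemma row_hits_le s s' y : le s s' -> row_hits s y <= row_hits s' y.
Proof.
move=> ss'; apply: zsum_le => x _; move: (ss' x y).
by case: (hit s x y) => [->|] //; case: (hit s' x y).
Qed.

Lemma row_hits_bound s y : 0 <= row_hits s y <= m.
Proof.
have h0 : 0 * Z.of_nat (Z.to_nat m) <= row_hits s y.
  by apply: zsum_ge => i _; case: (hit s i y).
have h1 : row_hits s y <= zsum (fun _ => 1) 0 (Z.to_nat m).
  by apply: zsum_le => i _; case: (hit s i y).
by rewrite zsum_const in h1; lia.
Qed.

Lemma hits_bound s : hits s <= m * n.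
Proof.
have h1 : hits s <= zsum (fun _ => m) 0 (Z.to_nat n).
  by apply: zsum_le => i _; have := row_hits_bound s i; lia.
by rewrite zsum_const in h1; lia.
Qed.

Definition closed s := forall s', le s s' -> hits s' <= hits s.

(** The hits are bounded by [m * n], so they can be increased only finitely often. *)
Lemma closed_ex s : exists2 s', le s s' & closed s'.
Proof.
have [k] : exists k : nat, m * n - hits s <= Z.of_nat k.
  by exists (Z.to_nat (m * n - hits s)); lia.
have not_closed s0 : ~ closed s0 -> exists2 s', le s0 s' & hits s0 < hits s'.
  move=> ncl; apply: NNPP => nex; apply: ncl => s' ss'.
  by apply/Z.nlt_ge => h; apply: nex; exists s'.
elim: k s => [|k IH] s sk; case: (classic (closed s)) => [cl|/not_closed[s' ss' h]].
- by exists s.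
- by have := hits_bound s'; lia.
- by exists s.
- have [|s'' h1 h2] := IH s'; first by lia.
  by exists s'' => //; apply: le_trans h1.
Qed.

(** No row loses hits in passing from [s] to [s'], so a gain in row [y] would raise the total. *)
Lemma closed_row s s' y : closed s -> le s s' -> row_hits s' y <= row_hits s y.
Proof.
move=> cs ss'; have := cs _ ss'; rewrite !(hitsE y).
have -> : Z.to_nat n = (Z.to_nat (n - 1)).+1 by lia.
have h : zsum (row_hits s) (y + 1) (Z.to_nat (n - 1)) <=
         zsum (row_hits s') (y + 1) (Z.to_nat (n - 1)).
  by apply: zsum_le => z _; apply: row_hits_le.
by rewrite /=; lia.
Qed.

(** The trail of a robber who has made [k] steps in direction [- sg] and now stands in column
    [x]. *)
Definition row_seg sg s y x k := forall i, 0 <= i <= k -> hit s (x + sg * i) y.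

Lemma row_seg_hits sg s y x k : sg = 1 \/ sg = -1 -> k < m ->
  row_seg sg s y x k -> k + 1 <= row_hits s y.
Proof.
move=> sg1 km seg; case: (Z_le_gt_dec 0 k) => k0; last first.
  by have := row_hits_bound s y; lia.
have [b hb] : exists b, forall i, b <= i < b + (k + 1) -> hit s i y.
  case: sg1 seg => -> seg.
    exists x => i hi; have := seg (i - x) ltac:(lia).
    by have -> : x + 1 * (i - x) = i by lia.
  exists (x - k) => i hi; have := seg (x - i) ltac:(lia).
  by have -> : x + -1 * (x - i) = i by lia.
rewrite (row_hitsE b).
have -> : Z.to_nat m = (Z.to_nat (k + 1) + Z.to_nat (m - k - 1))%nat.
  by rewrite -plusE; lia.
rewrite zsum_cat.
have h1 : 1 * Z.of_nat (Z.to_nat (k + 1)) <=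
    zsum (fun x => Z.b2z (hit s x y)) b (Z.to_nat (k + 1)).
  by apply: zsum_ge => i hi; rewrite hb //; lia.
have h2 : 0 * Z.of_nat (Z.to_nat (m - k - 1)) <=
    zsum (fun x => Z.b2z (hit s x y)) (b + Z.of_nat (Z.to_nat (k + 1))) (Z.to_nat (m - k - 1)).
  by apply: zsum_ge => i hi; case: (hit s i y).
by lia.
Qed.

(* The cop stands at offset (sg * d, tg * a) from the robber, up to wrapping;
   the signs allow every argument to be made up to reflection. *)
Definition offset sg tg s d a := (sg = 1 \/ sg = -1) /\ (tg = 1 \/ tg = -1) /\
  exists i j, cx s - rx s = sg * d + i * m /\ cy s - ry s = tg * a + j * n.

Lemma circ_sign k sg z i : 1 < k -> sg = 1 \/ sg = -1 -> circ k (sg * z + i * k) = circ k z.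
Proof.
move=> k1 [->|->]; rewrite circ_addm; first by congr circ; lia.
by rewrite -circ_opp //; congr circ; lia.
Qed.

Lemma offset_apart sg tg s d a : offset sg tg s d a -> 1 <= circ m d + circ n a.
Proof.
case=> sg1 [tg1 [i [j [dE aE]]]]; have := apart s.
by rewrite dE aE !circ_sign //; lia.
Qed.

Lemma move sg tg s d a u v : offset sg tg s d a -> Z.abs u + Z.abs v <= 1 ->
  2 <= circ m (d - u) + circ n (a - v) ->
  exists s' e h, [/\ le s s', rx s' = rx s + sg * u, ry s' = ry s + tg * v,
    Z.abs e + Z.abs h <= 1 & offset sg tg s' (d - u + e) (a - v + h)].
Proof.
case=> sg1 [tg1 [i [j [dE aE]]]] uv safe.
have [||s' [rx' ry' cop' ss']] := move_ex s (sg * u) (tg * v).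
- by case: sg1 tg1 => -> [] ->; lia.
- have -> : cx s - rx s - sg * u = sg * (d - u) + i * m by lia.
  have -> : cy s - ry s - tg * v = tg * (a - v) + j * n by lia.
  by rewrite !circ_sign //; lia.
exists s', (sg * (cx s' - cx s)), (tg * (cy s' - cy s)); split=> //.
  by case: sg1 tg1 => -> [] ->; lia.
do 2?split=> //; exists i, j; rewrite rx' ry'.
by case: sg1 tg1 dE aE => -> [] -> dE aE; lia.
Qed.

Lemma offset_shift sg tg s d a i j : offset sg tg s d a -> offset sg tg s (d + i * m) (a + j * n).
Proof.
case=> sg1 [tg1 [i' [j' [dE aE]]]]; do 2?split=> //.
by case: sg1 tg1 dE aE => -> [] -> dE aE;
  [exists (i' - i), (j' - j) | exists (i' - i), (j' + j)
  |exists (i' + i), (j' - j) | exists (i' + i), (j' + j)]; lia.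
Qed.

Lemma offset_flipx sg tg s d a : offset sg tg s d a -> offset (- sg) tg s (- d) a.
Proof.
case=> sg1 [tg1 [i [j [dE aE]]]]; split; [lia | split=> //]; exists i, j; lia.
Qed.

Lemma offset_flipy sg tg s d a : offset sg tg s d a -> offset sg (- tg) s d (- a).
Proof.
case=> sg1 [tg1 [i [j [dE aE]]]]; split; [lia | split; [lia | ]]; exists i, j; lia.
Qed.

Lemma offset_ex s : exists sg tg d a,
  offset sg tg s d a /\ 0 <= d /\ 2 * d <= m /\ 0 <= a /\ 2 * a <= n.
Proof.
have [|sg [d [i [sg1 [dE [d0 dm]]]]]] := circ_canon m _ (cx s - rx s); first lia.
have [|tg [a [j [tg1 [aE [a0 an]]]]]] := circ_canon n _ (cy s - ry s); first lia.
by exists sg, tg, d, a; do 4?split=> //; exists i, j.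
Qed.
(* The last two conjuncts follow from the first; they spare later uses of
   [circ_lip]. *)
Definition cop_step d a d' a' := Z.abs (d' - d) + Z.abs (a' - a) <= 1 /\
  Z.abs (circ m d' - circ m d) <= Z.abs (d' - d) /\
  Z.abs (circ n a' - circ n a) <= Z.abs (a' - a).

Lemma move_step {sg tg s d a} u v d1 a1 : offset sg tg s d a ->
  d1 = d - u -> a1 = a - v -> Z.abs u + Z.abs v <= 1 -> 2 <= circ m d1 + circ n a1 ->
  exists s' d' a', [/\ le s s', rx s' = rx s + sg * u, ry s' = ry s + tg * v,
    offset sg tg s' d' a' & cop_step d1 a1 d' a'].
Proof.
move=> off -> -> uv safe; have [s' [e [h [ss' rx' ry' eh off']]]] := move _ _ _ _ _ _ _ off uv safe.
exists s', (d - u + e), (a - v + h); split=> //; split; first lia.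
by split; [have := circ_lip m _ (d - u) e | have := circ_lip n _ (a - v) h]; lia.
Qed.

Lemma move_away {sg tg s d a} : offset sg tg s d a -> 2 <= circ m (d + 1) + circ n a ->
  exists s' d' a', [/\ le s s', rx s' = rx s - sg, ry s' = ry s,
    offset sg tg s' d' a' & cop_step (d + 1) a d' a'].
Proof.
move=> off safe; have [|||s' [d' [a' [ss' rx' ry' off' st]]]] :=
  move_step (-1) 0 (d + 1) a off _ _ _ safe; try lia.
by exists s', d', a'; split=> //; lia.
Qed.

Lemma move_up {sg tg s d a} : offset sg tg s d a -> 2 <= circ m d + circ n (a - 1) ->
  exists s' d' a', [/\ le s s', rx s' = rx s, ry s' = ry s + tg,
    offset sg tg s' d' a' & cop_step d (a - 1) d' a'].
Proof.
move=> off safe; have [|||s' [d' [a' [ss' rx' ry' off' st]]]] :=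
  move_step 0 1 d (a - 1) off _ _ _ safe; try lia.
by exists s', d', a'; split=> //; lia.
Qed.

Lemma cm_ge0 z : 0 <= circ m z. Proof. by apply: circ_ge0; lia. Qed.
Lemma cn_ge0 z : 0 <= circ n z. Proof. by apply: circ_ge0; lia. Qed.
Lemma cm_le z : 2 * circ m z <= m. Proof. by apply: circ_le; lia. Qed.
Lemma cn_le z : 2 * circ n z <= n. Proof. by apply: circ_le; lia. Qed.
Lemma cm_small z : 0 <= z <= m -> circ m z = Z.min z (m - z).
Proof. by apply: circ_small; lia. Qed.
Lemma cn_small z : 0 <= z <= n -> circ n z = Z.min z (n - z).
Proof. by apply: circ_small; lia. Qed.

(** A round lowers [a + circ m d] by at most 2, one for each player, and the robber's step is safe
    while this sum is at least 3. A cop who slips past the robber is counted [n] rows further ahead,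
    which only increases the sum. *)
Lemma climb (k : nat) {sg tg s d a} : offset sg tg s d a -> 1 <= a <= n ->
  2 * Z.of_nat k <= a + circ m d - 1 ->
  exists2 s', le s s' & ry s' = ry s + tg * Z.of_nat k.
Proof.
elim: k s d a => [|k IH] s d a off an hk; first by exists s => //; lia.
have := cn_small (a - 1); have := cm_ge0 d; have := offset_apart _ _ _ _ _ off.
have := cn_small a => hn1 hd hn2 hm.
have [|s1 [d' [a' [ss1 _ ry1 off1 [st [st1 st2]]]]]] := move_up off; first lia.
case: (Z_le_gt_dec a' 0) => a'0.
  have [||s' h1 h2] := IH _ _ _ (offset_shift _ _ _ _ _ 0 1 off1); first lia.
    by rewrite Z.mul_0_l Z.add_0_r; lia.
  by exists s'; [apply: le_trans h1 | lia].
have [||s' h1 h2] := IH _ _ _ off1; try lia.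
by exists s'; [apply: le_trans h1 | lia].
Qed.

Lemma row_seg0 sg s : row_seg sg s (ry s) (rx s) 0.
Proof.
move=> i hi; have -> : i = 0 by lia.
by rewrite Z.mul_0_r Z.add_0_r hit_cur.
Qed.

Lemma row_seg_step sg s s' k : le s s' -> rx s' = rx s - sg -> ry s' = ry s ->
  row_seg sg s (ry s) (rx s) k -> row_seg sg s' (ry s') (rx s') (k + 1).
Proof.
move=> ss' rx' ry' seg i hi; case: (Z.eq_dec i 0) => [->|i0].
  by rewrite Z.mul_0_r Z.add_0_r hit_cur.
apply: ss'; rewrite rx' ry'; have -> : rx s - sg + sg * i = rx s + sg * (i - 1) by lia.
by apply: seg; lia.
Qed.

(* P is an invariant of the run, Q stops it. *)
Lemma run_away {sg tg s d a} (P : Z -> Z -> Z -> Prop) (Q : state A -> Z -> Z -> Z -> Prop) :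
  offset sg tg s d a -> P 0 d a ->
  (forall s' i d' a', offset sg tg s' d' a' -> le s s' -> ry s' = ry s -> 0 <= i ->
    P i d' a' -> Q s' i d' a' \/
    2 <= circ m (d' + 1) + circ n a' /\
    (forall d'' a'', cop_step (d' + 1) a' d'' a'' ->
      (forall s'', offset sg tg s'' d'' a'' -> le s s'' -> P (i + 1) d'' a''))) ->
  forall k, 0 <= k -> exists s' i d' a', [/\ le s s', ry s' = ry s, offset sg tg s' d' a',
    row_seg sg s' (ry s') (rx s') i & 0 <= i /\ P i d' a' /\ (i <= k /\ Q s' i d' a' \/ i = k)].
Proof.
move=> off P0 step k k0; have -> : k = Z.of_nat (Z.to_nat k) by lia.
elim: (Z.to_nat k) => {k k0} [|k [s1 [i [d1 [a1 [ss1 ry1 off1 seg [i0 [Pi [Qi|iE]]]]]]]]].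
- by exists s, 0, d, a; split=> //; [apply: row_seg0 | split=> //; split=> //; right].
- exists s1, i, d1, a1; split=> //; do 2?split=> //; left; split; [lia | by case: Qi].
- have [Q1|[safe next]] := step _ _ _ _ off1 ss1 ry1 i0 Pi.
    exists s1, i, d1, a1; split=> //; do 2?split=> //; left; split=> //; lia.
  have [s2 [d2 [a2 [ss2 rx2 ry2 off2 st]]]] := move_away off1 safe.
  have ss2' : le s s2 by apply: le_trans ss2.
  exists s2, (i + 1), d2, a2; split=> //; first by rewrite ry2.
    exact: row_seg_step rx2 ry2 seg.
  split; first lia; split; first exact: next off2 ss2'.
  by right; lia.
Qed.
Lemma cm_neg z : - m <= z <= 0 -> circ m z = Z.min (- z) (m + z).
Proof. by move=> zm; rewrite -circ_opp ?cm_small; lia. Qed.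

Lemma row_seg_full sg s k : sg = 1 \/ sg = -1 -> m - 1 <= k ->
  row_seg sg s (ry s) (rx s) k -> row_hits s (ry s) = m.
Proof.
move=> sg1 km seg; have := row_hits_bound s (ry s).
have := row_seg_hits sg s (ry s) (rx s) (m - 1) sg1 ltac:(lia) => h1 h2.
have := h1 (fun i hi => seg i ltac:(lia)); lia.
Qed.

Variable L : Z.
Hypotheses (L_ge1 : 1 <= L) (L_half : 2 * L + 1 <= m).

Lemma row_seg_long sg s k c : sg = 1 \/ sg = -1 -> c <= k + 1 -> c <= m ->
  row_seg sg s (ry s) (rx s) k -> c <= row_hits s (ry s).
Proof.
move=> sg1 ck cm seg; case: (Z_le_gt_dec m k) => km.
  by have := row_seg_full _ _ _ sg1 _ seg; lia.
by have := row_seg_hits _ _ _ _ _ sg1 _ seg; lia.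
Qed.

(* Keeping the columns of the players apart, the robber first approaches the
   cop's column and then runs away from it. *)
Lemma sweep s : exists s', [/\ le s s', ry s' = ry s & L <= row_hits s' (ry s)].
Proof.
have leave_column : exists s' sg tg d a, [/\ le s s', ry s' = ry s, offset sg tg s' d a &
    row_hits s' (ry s') = m \/ 1 <= d <= m - 1].
  have [sg [tg [d [a [off [d0 [dm _]]]]]]] := offset_ex s.
  have [|||s1 [i [d1 [a1 [ss1 ry1 off1 seg [i0 [Pi h]]]]]]] := run_away
    (fun _ d _ => 0 <= d <= m - 1) (fun _ _ d _ => 1 <= d) off _ _ (m - 1).
  - by lia.
  - move=> s' i d' a' off' _ _ _ d'0; case: (Z.eq_dec d' 0) => [d'E|]; last lia.
    right; subst d'; have := offset_apart _ _ _ _ _ off'.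
    have := cm_small 0; have := cm_small (0 + 1) => h1 h2 h3.
    by split; [lia | rewrite /cop_step; lia].
  - by lia.
  exists s1, sg, tg, d1, a1; split=> //.
  case: h => [[_ Qd]|iE]; first by right; lia.
  by left; apply: row_seg_full seg; [case: off | lia].
have [s1 [sg [tg [d [a [ss1 ry1 off1 [full|d1]]]]]]] := leave_column.
  by exists s1; split=> //; rewrite -ry1; lia.
(* In the flipped frame, running away means walking towards the cop; the walk ends at horizontal
   distance at most 2. *)
have [|||s2 [i [d2 [a2 [ss2 ry2 off2 seg [i0 [Pi h]]]]]]] := run_away
  (fun _ d _ => 1 - m <= d <= -1) (fun _ _ d _ => -2 <= d) (offset_flipx _ _ _ _ _ off1) _ _ (m - 1).
- by lia.
- move=> s' i d' a' off' _ _ _ Pd; case: (Z_le_gt_dec (-2) d') => d'2; first by left.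
  right; have := cm_neg (d' + 1); have := cn_ge0 a' => h1 h2.
  by split; [lia | rewrite /cop_step; lia].
- by lia.
have ss2' : le s s2 by apply: le_trans ss2.
case: h => [[_ Qd]|iE]; last first.
  exists s2; split=> //; first lia.
  by have := row_seg_full _ _ _ _ _ seg; rewrite ry2 ry1; case: off2; lia.
(* The distance grows by at most 2 a round, so before round [L - 1] the cop is too near behind to
   appear in front of the robber. *)
have [|||s3 [i' [d3 [a3 [ss3 ry3 off3 seg3 [i'0 [Pi' h']]]]]]] := run_away
  (fun i d _ => 1 <= d <= 2 + 2 * i) (fun _ i _ _ => L - 1 <= i) (offset_flipx _ _ _ _ _ off2) _ _ (L - 1).
- by lia.
- move=> s' j d' a' off' _ _ j0 Pd; case: (Z_le_gt_dec (L - 1) j) => jL; first by left.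
  right; have := cm_small (d' + 1); have := cn_ge0 a' => h1 h2.
  by split; [lia | rewrite /cop_step; lia].
- by lia.
exists s3; split; [exact: le_trans ss3 | lia | ].
have -> : ry s = ry s3 by lia.
by apply: row_seg_long seg3; [case: off3 | lia | lia].
Qed.
Lemma circ_offset {sg tg s d a} : offset sg tg s d a ->
  circ m d = circ m (cx s - rx s) /\ circ n a = circ n (cy s - ry s).
Proof. by case=> sg1 [tg1 [i [j [-> ->]]]]; rewrite !circ_sign //; lia. Qed.

Lemma cm_wrap z : m <= z <= 2 * m -> circ m z = Z.min (z - m) (2 * m - z).
Proof.
move=> zm; rewrite -(circ_addm m z (-1)) cm_small; lia.
Qed.

Definition unreachable s0 b := forall s, le s0 s -> forall i, ry s <> b + i * n.

(** * Consequences of an unreachable row *)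

Section Unreachable.
Variables (s0 : state A) (b : Z).
Hypothesis s0b : unreachable s0 b.

(** Contrapositive of [climb]: from any greater distance the cop could not keep the robber out of
    row [b]. *)
Lemma climb_blocked {sg tg s d a} t i : le s0 s -> offset sg tg s d a ->
  1 <= a <= n -> 0 <= t -> ry s + tg * t = b + i * n -> a + circ m d <= 2 * t.
Proof.
move=> s0s off an t0 rb; apply/Z.nlt_ge => h.
have [||s' ss' ry'] := climb (Z.to_nat t) off; try lia.
by case: (s0b s' (le_trans _ _ _ s0s ss') i); rewrite ry' Z2Nat.id.
Qed.

Lemma row_distance s tg : tg = 1 \/ tg = -1 ->
  exists (t : nat) (i : Z), Z.of_nat t < n /\ ry s + tg * Z.of_nat t = b + i * n.
Proof.
move=> tg1; have tb := Z.mod_pos_bound (tg * (b - ry s)) n.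
have tE := Z_div_mod_eq_full (tg * (b - ry s)) n.
exists (Z.to_nat ((tg * (b - ry s)) mod n)), (- tg * ((tg * (b - ry s)) / n)).
by rewrite Z2Nat.id; case: tg1 tb tE => -> tb tE; lia.
Qed.

(** A cop in the robber's row is [n] rows ahead in both directions. Blocking both ways to row [b]
    gives [n + D <= 2t] and [n + D <= 2(n - t)] with [D = circ m d]; adding them leaves [D = 0], a
    capture. *)
Lemma not_same_row {sg tg s d} : le s0 s -> offset sg tg s d 0 -> False.
Proof.
move=> s0s off; have tg1 : tg = 1 \/ tg = -1 by case: off => _ [].
have [t [i [tn tE]]] := row_distance s tg tg1.
have h1 := climb_blocked (Z.of_nat t) i s0s (offset_shift _ _ _ _ _ 0 1 off) ltac:(lia) ltac:(lia) tE.
have h2 := climb_blocked (n - Z.of_nat t) (i - tg) s0s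
  (offset_shift _ _ _ _ _ 0 1 (offset_flipy _ _ _ _ _ off)) ltac:(lia) ltac:(lia) ltac:(lia).
have := offset_apart _ _ _ _ _ off; have := cn_small 0.
by rewrite !Z.mul_0_l !Z.add_0_r in h1 h2; lia.
Qed.

(* While the vertical distance is smaller than the horizontal one, the robber
   may move towards the cop's row. If he ever shares it, the cop cannot block
   both ways round; if the cop jumps over his row, the two states before and
   after the jump lead to row b from opposite sides. *)
Lemma chase (t : nat) {sg tg s d a i} : le s0 s -> offset sg tg s d a ->
  1 <= a < circ m d -> ry s + tg * Z.of_nat t = b + i * n -> Z.of_nat t <= n -> False.
Proof.
elim: t s d a => [|t IH] s d a s0s off ad rb tn; first by apply: (s0b s s0s i); lia.
have [|s1 [d' [a' [ss1 _ ry1 off1 [st [st1 st2]]]]]] := move_up off.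
  by have := cn_ge0 (a - 1); have := cm_le d; lia.
have s0s1 := le_trans _ _ _ s0s ss1.
case: (Z_lt_ge_dec 0 a') => a'0.
  by apply: (IH s1 d' a' s0s1 off1); lia.
case: (Z.eq_dec a' 0) => [a'E|a'N]; first by subst a'; exact: not_same_row off1.
have a'E : a' = -1 by lia.
subst a'; have aE : a = 1 by lia.
subst a; have d'E : d' = d by lia.
subst d'.
have h1 := climb_blocked (Z.of_nat t) i s0s1 (offset_shift _ _ _ _ _ 0 1 off1) ltac:(lia) ltac:(lia) ltac:(lia).
have h2 := climb_blocked (n - Z.of_nat t.+1) (i - tg) s0s
  (offset_shift _ _ _ _ _ 0 1 (offset_flipy _ _ _ _ _ off)) ltac:(lia) ltac:(lia) ltac:(lia).
by rewrite !Z.mul_0_l !Z.add_0_r in h1 h2; lia.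
Qed.

(** [not_same_row] excludes vertical distance 0 and [chase] excludes a positive one below the
    horizontal distance. *)
Lemma cone {sg tg s d a} : le s0 s -> offset sg tg s d a ->
  circ m d <= circ n a /\ 1 <= circ n a.
Proof.
move=> s0s /circ_offset[-> ->].
have [sg' [tg' [d' [a' [off [d0 [dm [a0 an]]]]]]]] := offset_ex s.
have [<- <-] := circ_offset off; rewrite cm_small ?cn_small; try lia.
case: (Z.eq_dec a' 0) => [aE|a'N]; first by subst a'; case: (not_same_row s0s off).
case: (Z_lt_ge_dec a' d') => ad; last lia.
have tg1 : tg' = 1 \/ tg' = -1 by case: off => _ [].
have [t [i [tn tE]]] := row_distance s tg' tg1.
by case: (chase t s0s off _ tE); rewrite ?cm_small; lia.
Qed.

(* The robber runs until the cop stands diagonally in front of him, then back.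
   To meet him again on the other side the cop has to go round the cycle while
   staying in the cone, which takes 2L - 1 rounds. *)
Lemma wide_row {s} : le s0 s -> exists s', [/\ le s s', ry s' = ry s & 2 * L <= row_hits s' (ry s)].
Proof.
move=> s0s; have [sg [tg [d [a [off _]]]]] := offset_ex s.
(* Inside the cone, a step is unsafe only if it leads into the cop's column while he is in an
   adjacent row; this is the stopping condition. *)
have [|||s1 [i [d1 [a1 [ss1 ry1 off1 seg [i0 [_ h]]]]]]] := run_away
  (fun _ _ _ => True) (fun _ _ d a => circ m (d + 1) = 0 /\ circ n a = 1) off _ _ (m - 1) => //.
- move=> s' j d' a' off' ss' _ _ _.
  have [h1 h2] := cone (le_trans _ _ _ s0s ss') off'; have := cm_ge0 (d' + 1).
  case: (Z.eq_dec (circ m (d' + 1)) 0) => [->|]; last by right; split=> //; lia.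
  by case: (Z.eq_dec (circ n a') 1) => [->|]; [left | right; split=> //; lia].
- by lia.
case: h => [[_ [dE aE]]|iE]; last first.
  exists s1; split=> //; rewrite -ry1; apply: row_seg_long seg; [by case: off1 | lia | lia].
have [k dE'] : exists k, d1 = -1 + k * m.
  move: dE; rewrite /circ => dE; have := Z_div_mod_eq_full (d1 + 1) m.
  have := Z.mod_pos_bound (d1 + 1) m => h1 h2.
  by exists ((d1 + 1) / m); lia.
have := offset_flipx _ _ _ _ _ (offset_shift _ _ _ _ _ (- k) 0 off1).
have -> : - (d1 + - k * m) = 1 by lia.
rewrite Z.mul_0_l Z.add_0_r => {off1 seg dE'}off1.
have s0s1 := le_trans _ _ _ s0s ss1.
(* With [A = circ n a], the sum [d + A] grows by at most 2 a round. When [d] reaches [L], the cone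
   forces [A >= L], whence [m - d + A + 2i >= m + 2L - 2]. From then on the left side never
   decreases, so the dangerous position [d = m - 1], [A = 1] needs [i >= 2L - 1]. *)
have [|||s2 [i' [d2 [a2 [ss2 ry2 off2 seg [i'0 [_ h]]]]]]] := run_away
  (fun i d a => 1 <= d /\ d + circ n a <= 2 + 2 * i /\
     (d < L \/ m + 2 * L - 2 <= m - d + circ n a + 2 * i))
  (fun _ i _ _ => 2 * L - 1 <= i) off1 _ _ (2 * L - 1).
- by lia.
- move=> s' j d' a' off' ss' _ j0 [Pd [Ps Pb]].
  case: (Z_le_gt_dec (2 * L - 1) j) => jL; [by left | right].
  have [h1 h2] := cone (le_trans _ _ _ s0s1 ss') off'; have := cm_ge0 (d' + 1).
  have := cm_small (d' + 1); have := cm_wrap (d' + 1) => h3 h4 h5.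
  split; first lia.
  move=> d'' a'' [st [st1 st2]] s'' off'' ss''.
  have [h6 h7] := cone (le_trans _ _ _ s0s1 ss'') off''; have := cm_small d''.
  by lia.
- by lia.
exists s2; split; [exact: le_trans ss2 | lia | ].
have -> : ry s = ry s2 by lia.
by apply: row_seg_long seg; [case: off2 | lia | lia].
Qed.

End Unreachable.
(** * Plays of maximal damage *)

Lemma half_ex z : exists h, 2 * h <= z <= 2 * h + 1.
Proof. by exists (Z.div2 z); have := Z.div2_odd z; case: (Z.odd z) => /=; lia. Qed.

(** The cop is [a] rows ahead in one direction and [n - a] in the other; the robber can climb either
    way. *)
Lemma rows_around u v {sg tg s d a} : offset sg tg s d a -> 1 <= a <= n - 1 ->
  2 * u <= a + circ m d - 1 -> 2 * v <= n - a + circ m d - 1 ->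
  exists b, forall y, b <= y < b + (u + v + 1) -> exists2 s', le s s' & ry s' = y.
Proof.
move=> off an hu hv; have tg1 : tg = 1 \/ tg = -1 by case: off => _ [].
have up t : 0 <= t <= u -> exists2 s', le s s' & ry s' = ry s + tg * t.
  move=> tu; have [||s' ss' ry'] := climb (Z.to_nat t) off; try lia.
  by exists s' => //; rewrite ry' Z2Nat.id; lia.
have down t : 0 <= t <= v -> exists2 s', le s s' & ry s' = ry s - tg * t.
  move=> tv; have off' := offset_shift _ _ _ _ _ 0 1 (offset_flipy _ _ _ _ _ off).
  rewrite Z.mul_0_l Z.add_0_r in off'.
  have [||s' ss' ry'] := climb (Z.to_nat t) off'; try lia.
  by exists s' => //; rewrite ry' Z2Nat.id; lia.
case: tg1 up down => -> up down; [exists (ry s - v) | exists (ry s - u)] => y yb.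
- case: (Z_le_gt_dec (ry s) y) => h.
    by have [|s' ss' ry'] := up (y - ry s); [lia | exists s' => //; lia].
  by have [|s' ss' ry'] := down (ry s - y); [lia | exists s' => //; lia].
- case: (Z_le_gt_dec (ry s) y) => h.
    by have [|s' ss' ry'] := down (y - ry s); [lia | exists s' => //; lia].
  by have [|s' ss' ry'] := up (ry s - y); [lia | exists s' => //; lia].
Qed.

Lemma hits_split s b w c : 0 <= w <= n -> (forall y, b <= y < b + w -> c <= row_hits s y) ->
  c * w + zsum (row_hits s) (b + w) (Z.to_nat (n - w)) <= hits s.
Proof.
move=> wn cy; rewrite (hitsE b).
have -> : Z.to_nat n = (Z.to_nat w + Z.to_nat (n - w))%nat by rewrite -plusE; lia.
rewrite zsum_cat Z2Nat.id; last lia.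
have h : c * Z.of_nat (Z.to_nat w) <= zsum (row_hits s) b (Z.to_nat w).
  by apply: zsum_ge => y yb; apply: cy; lia.
by rewrite Z2Nat.id in h; lia.
Qed.

Lemma zsum_hits_ge0 s b k : 0 <= zsum (row_hits s) b k.
Proof.
have : 0 * Z.of_nat k <= zsum (row_hits s) b k.
  by apply: zsum_ge => y _; have := row_hits_bound s y; lia.
by lia.
Qed.

(** The robber runs along his row. A cop who has to be in his column after every answer must follow
    him all the way round. *)
Lemma same_column_row s : (forall s', le s s' -> circ m (cx s' - rx s') = 0) ->
  exists s', [/\ le s s', ry s' = ry s & m <= row_hits s' (ry s)].
Proof.
move=> sync; have [sg [tg [d [a [off [d0 [dm _]]]]]]] := offset_ex s.
have [h1 _] := circ_offset off; rewrite (sync s (le_refl s)) cm_small in h1; last lia.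
have [|||s1 [i [d1 [a1 [ss1 ry1 off1 seg [i0 [_ h]]]]]]] := run_away
  (fun _ d _ => d = 0) (fun _ _ _ _ => False) off _ _ (m - 1).
- by lia.
- move=> s' j d' a' off' _ _ _ d'E; subst d'; right.
  have := offset_apart _ _ _ _ _ off'; have := cm_small 0; have := cm_small (0 + 1).
  split; first lia.
  move=> d'' a'' [st _] s'' off'' ss''; have [h2 _] := circ_offset off''.
  by rewrite (sync s'' ss'') cm_small in h2; lia.
- by lia.
exists s1; split=> //; rewrite -ry1.
case: h => [[]//|iE]; have := row_seg_full _ _ _ _ _ seg.
by case: off1 => sg1 _ h; rewrite h //; lia.
Qed.

Variable (Ln E : Z).
Hypotheses (Ln_half : 2 * Ln + 1 <= n <= 2 * Ln + 2) (E_def : n * L <= Ln * m + E).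

(* Whatever rows the cop may eventually confine the robber to, E damaged
   vertices lie outside. *)
Definition spread s := forall w, E <= zsum (row_hits s) (w + Ln) (Z.to_nat (n - Ln)).

Lemma spread_le s s' : le s s' -> spread s -> spread s'.
Proof.
move=> ss' sp w; have := sp w; have := zsum_le (row_hits s) (row_hits s') (w + Ln) (Z.to_nat (n - Ln)).
by move=> h1 h2; have := h1 (fun y _ => row_hits_le _ _ y ss'); lia.
Qed.

Lemma closed_hits s : closed s -> spread s -> n * L <= hits s.
Proof.
move=> cl sp; case: (classic (exists b, unreachable s b)) => [[b sb]|reach]; last first.
  have rowL y : L <= row_hits s y.
    apply: NNPP => yL; apply: reach; exists y => s' ss' i ry'.
    have [s'' [ss'' ry'' h]] := sweep s'.
    have := closed_row _ _ (ry s') cl (le_trans _ _ _ ss' ss'').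
    by rewrite ry' !row_hits_per in h *; lia.
  have := hits_split s 0 n L ltac:(lia) (fun y _ => rowL y).
  by have := zsum_hits_ge0 s (0 + n) (Z.to_nat (n - n)); lia.
case: (classic (forall s', le s s' -> circ m (cx s' - rx s') = 0)) => [sync|nsync].
  have [sg [tg [d [a [off [d0 [dm [a0 an]]]]]]]] := offset_ex s.
  have [h1 h2] := cone _ _ sb (le_refl s) off.
  rewrite cn_small in h2; last lia.
  have [h3 _] := circ_offset off; rewrite (sync s (le_refl s)) in h3.
  (* With the cop in the robber's column, the two climbs cover [u + v + 1 >= Ln] rows, each of which
     can be damaged completely. *)
  have [u hu] := half_ex (a - 1); have [v hv] := half_ex (n - a - 1).
  have [|||b0 rows] := rows_around u v off; try lia.
  have full y : b0 <= y < b0 + Ln -> m <= row_hits s y.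
    move=> yb; have [|s' ss' ry'] := rows y; first lia.
    have [s'' ss''|s'' [ss'' ry'' h]] := same_column_row s'.
      by apply: sync; apply: le_trans ss''.
    have := closed_row _ _ y cl (le_trans _ _ _ ss' ss'').
    by rewrite ry' in h; lia.
  by have := hits_split s b0 Ln m ltac:(lia) full; have := sp b0; lia.
have [s1 ss1 D1] : exists2 s1, le s s1 & 1 <= circ m (cx s1 - rx s1).
  apply: NNPP => nex; apply: nsync => s' ss'.
  have := cm_ge0 (cx s' - rx s').
  by case: (Z_le_gt_dec 1 (circ m (cx s' - rx s'))) => h; [case: nex; exists s' | lia].
have [sg [tg [d [a [off [d0 [dm [a0 an]]]]]]]] := offset_ex s1.
have [h1 h2] := cone _ _ sb ss1 off; rewrite cn_small in h2; last lia.
have [h3 _] := circ_offset off; rewrite -h3 in D1.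
(* Horizontal distance at least 1 lengthens both climbs enough to cover [w >= n/2] rows. They may
   wrap round the torus, hence [Z.min n w] below. *)
have [u hu] := half_ex (a + circ m d - 1); have [v hv] := half_ex (n - a + circ m d - 1).
have [|||b0 rows] := rows_around u v off; try lia.
have [w wE] : exists w, w = u + v + 1 by exists (u + v + 1).
have w_half : n <= 2 * w by lia.
rewrite -wE in rows.
have wide y : b0 <= y < b0 + Z.min n w -> 2 * L <= row_hits s y.
  move=> yb; have [|s' ss' ry'] := rows y; first lia.
  have ss'1 := le_trans _ _ _ ss1 ss'.
  have [s'' [ss'' ry'' h]] := wide_row _ _ sb ss'1.
  have := closed_row _ _ y cl (le_trans _ _ _ ss'1 ss'').
  by rewrite ry' in h; lia.
have := hits_split s b0 (Z.min n w) (2 * L) ltac:(lia) wide.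
by have := zsum_hits_ge0 s (b0 + Z.min n w) (Z.to_nat (n - Z.min n w)); nia.
Qed.
(** * Damage spread over distant rows *)

(** The robber keeps running as long as the cop restores the offset [(d, a)]. Either this lasts for
    a full turn or the robber gets rid of that offset. *)
Lemma loop {sg tg s d a} : offset sg tg s d a -> 2 <= circ m (d + 1) + circ n a ->
  exists s' d' a', [/\ le s s', ry s' = ry s, offset sg tg s' d' a' &
    [/\ d' = d, a' = a & row_hits s' (ry s') = m] \/
    cop_step (d + 1) a d' a' /\ ~ (d' = d /\ a' = a)].
Proof.
move=> off safe; have [|||s1 [i [d1 [a1 [ss1 ry1 off1 seg [i0 [Pi h]]]]]]] := run_away
  (fun _ d' a' => d' = d /\ a' = a \/ cop_step (d + 1) a d' a' /\ ~ (d' = d /\ a' = a))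
  (fun _ _ d' a' => ~ (d' = d /\ a' = a)) off _ _ (m - 1).
- by left.
- move=> s' j d' a' _ _ _ _ [[-> ->]|[_ ne]]; [right | by left].
  by split=> // d'' a'' st _ _ _; case: (classic (d'' = d /\ a'' = a)); [left | right].
- by lia.
exists s1, d1, a1; split=> //; case: Pi => [[dE aE]|]; last by right.
left; split=> //; case: h => [[_ []]//|iE].
by apply: row_seg_full seg; [case: off1 | lia].
Qed.

Lemma vertical_canon {sg tg s d a} : offset sg tg s d a -> exists tg' a',
  [/\ offset sg tg' s d a', 0 <= a', 2 * a' <= n & circ n a = a'].
Proof.
move=> off; have [|t [w [i [t1 [aE [w0 wn]]]]]] := circ_canon n _ a; first lia.
have wE : circ n a = w by rewrite aE circ_sign ?cn_small; lia.
have := offset_shift _ _ _ _ _ 0 (- i) off.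
rewrite Z.mul_0_l Z.add_0_r; have -> : a + - i * n = t * w by lia.
case: t1 => ->; rewrite ?Z.mul_1_l => off'; first by exists tg, w.
exists (- tg), w; split=> //; have := offset_flipy _ _ _ _ _ off'.
by have -> : - (-1 * w) = w by lia.
Qed.

(* The robber starts at distance 2 from the cop in his row. The offset (3, 0)
   leaves too little room for running away, so he first follows the cop. *)
Lemma first_row : exists s sg tg d a,
  [/\ offset sg tg s d a, 0 <= a, 2 * a <= n, a <= circ m d & 1 <= circ m d] /\
  L <= row_hits s (ry s) /\
  (row_hits s (ry s) = m \/
   [/\ 1 <= d, 1 <= m - d, a <= d, a <= m - d & d <= 2 \/ d <= a + 1]).
Proof.
have [|s0 st0] := start_ex A 2 0.
  by have := cm_small 2; have := cn_small 0; lia.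
have off0 : offset 1 1 s0 (cx s0 - rx s0) (cy s0 - ry s0).
  by split; [left | split; [left | exists 0, 0; lia]].
have small a : -1 <= a <= 1 -> circ n a = Z.abs a.
  move=> a1; case: (Z_le_gt_dec 0 a) => a0; first by rewrite cn_small; lia.
  by rewrite -circ_opp ?cn_small; lia.
have first_state : exists s sg tg d a, offset sg tg s d a /\
    (row_hits s (ry s) = m /\ d = -3 /\ a = 0 \/
     1 <= d <= 2 /\ -1 <= a <= 1 /\ (d = 1 -> a = 0)).
  case: (Z.eq_dec (cx s0 - rx s0) 3) => [dE|dN]; last first.
    by exists s0, 1, 1, (cx s0 - rx s0), (cy s0 - ry s0); split=> //; right; lia.
  have aE : cy s0 - ry s0 = 0 by lia.
  rewrite dE aE in off0; have [|s1 [d1 [a1 [_ _ off1 h]]]] := loop (offset_flipx _ _ _ _ _ off0).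
    by have := cm_neg (- (3) + 1); have := cn_ge0 0; lia.
  case: h => [[h1 h2 h3]|[[st _] ne]]; first by exists s1, (-(1)), 1, d1, a1; split=> //; left; lia.
  exists s1, (- -(1)), 1, (- d1), a1; split; first exact: offset_flipx.
  by right; lia.
have [s1 [sg [tg [d [a [off1 [[full [dE aE]]|[d12 [a1 d1]]]]]]]]] := first_state.
  exists s1, sg, tg, d, a; subst d a; have := cm_neg (-3) => h.
  by split; [split=> //; lia | split; [lia | left]].
(* The bounds on [d + circ n a] and [d - circ n a] grow by 2 a round, as fast as the players can
   change these quantities. Together with the stopping condition they force [L - 1 <= i]. *)
have [|||s2 [i [d2 [a2 [ss2 ry2 off2 seg [i0 [Pi h]]]]]]] := run_away
  (fun i d a => 1 <= d /\ 1 <= m - d /\ circ n a <= d /\ circ n a <= m - d /\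
     d + circ n a <= 3 + 2 * i /\ d - circ n a <= 2 + 2 * i)
  (fun _ _ d a => m - d <= 2 \/ m - d <= circ n a + 1) off1 _ _ (m - 1).
- by rewrite small //; lia.
- move=> s' j d' a' _ _ _ j0 Pj; have := cn_ge0 a'.
  case: (Z_le_gt_dec (m - d') 2) => e1; first by left; left.
  case: (Z_le_gt_dec (m - d') (circ n a' + 1)) => e2; first by left; right.
  right; have := cm_small (d' + 1); split; first lia.
  by move=> d'' a'' [st [_ st2]] _ _ _; lia.
- by lia.
have [tg' [a' [off' a'0 a'n aE]]] := vertical_canon off2.
have sg1 : sg = 1 \/ sg = -1 by case: off2.
case: h => [[ik Q]|iE].
- have := offset_flipx _ _ _ _ _ (offset_shift _ _ _ _ _ (-1) 0 off').
  have -> : - (d2 + -1 * m) = m - d2 by lia.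
  rewrite Z.mul_0_l Z.add_0_r => off3; have := cm_small (m - d2) => h.
  exists s2, (- sg), tg', (m - d2), a'; split; first by split=> //; lia.
  split; last by right; split; lia.
  by apply: row_seg_long seg => //; lia.
- have full : row_hits s2 (ry s2) = m by apply: row_seg_full seg => //; lia.
  exists s2, sg, tg', d2, a'; have := cm_small d2 => h.
  by split; [split=> //; lia | split; [lia | left]].
Qed.

(** Since [n > 2 Ln], no cyclic window of [Ln] rows contains two rows that are [Ln] apart. *)
Lemma spread_two_rows s y z : z = y + Ln \/ z = y - Ln -> 0 <= Ln ->
  E <= row_hits s y -> E <= row_hits s z -> spread s.
Proof.
move=> yz Ln0 hy hz w.
wlog yz' : y z hy hz {yz} / z = y + Ln.
  by case: yz => yz; [apply; [exact: hy | exact: hz | ] | apply; [exact: hz | exact: hy | ]]; lia.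
have one_row v : 0 <= v < n - Ln -> E <= row_hits s (w + Ln + v) ->
    E <= zsum (row_hits s) (w + Ln) (Z.to_nat (n - Ln)).
  move=> vn hv; have -> : Z.to_nat (n - Ln) = (Z.to_nat v + (1 + Z.to_nat (n - Ln - v - 1)))%nat.
    by rewrite -!plusE; lia.
  rewrite !zsum_cat Z2Nat.id /=; last lia.
  have := zsum_hits_ge0 s (w + Ln) (Z.to_nat v).
  by have := zsum_hits_ge0 s (w + Ln + v + 1) (Z.to_nat (n - Ln - v - 1)); lia.
have rb := Z.mod_pos_bound (y - w) n; have rE := Z_div_mod_eq_full (y - w) n.
case: (Z_le_gt_dec Ln ((y - w) mod n)) => h.
  apply: (one_row ((y - w) mod n - Ln)); first lia.
  rewrite -(row_hits_per _ _ ((y - w) / n)).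
  by have -> : w + Ln + ((y - w) mod n - Ln) + (y - w) / n * n = y by lia.
apply: (one_row ((y - w) mod n)); first lia.
rewrite -(row_hits_per _ _ ((y - w) / n)).
by have -> : w + Ln + (y - w) mod n + (y - w) / n * n = z by lia.
Qed.

(** In the first row [a <= circ m d], which is just enough for the robber to flee [Ln] rows from the
    cop's row and sweep there. *)
Lemma spread_pair : E <= L -> exists s, spread s.
Proof.
move=> EL; have [s [sg [tg [d [a [[off a0 an ad d1] [hL _]]]]]]] := first_row.
have := offset_shift _ _ _ _ _ 0 1 (offset_flipy _ _ _ _ _ off).
rewrite Z.mul_0_l Z.add_0_r => off'.
have [||s1 ss1 ry1] := climb (Z.to_nat Ln) off'; try lia.
have [s2 [ss2 ry2 h]] := sweep s1.
exists s2; apply: (spread_two_rows _ (ry s) (ry s1)); try lia.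
  by rewrite ry1; case: off' => _ [[->|->] _]; lia.
by have := row_hits_le _ _ (ry s) (le_trans _ _ _ ss1 ss2); lia.
Qed.
Lemma row_hits_ge0 s y : 0 <= row_hits s y.
Proof. by have := row_hits_bound s y; lia. Qed.

(** * Even height: damage in two opposite pairs of adjacent rows *)

Section EvenHeight.
Variable N : Z.
Hypotheses (n_even : n = 2 * N) (NL : N <= L) (E_le : E <= 2 * L + 1 - N).

(** The two pairs are opposite each other, so a window of [Ln = N - 1] rows misses at least one of
    them entirely. *)
Lemma spread_four_rows s p : E <= row_hits s p + row_hits s (p + 1) ->
  E <= row_hits s (p + N) + row_hits s (p + N + 1) -> spread s.
Proof.
move=> h1 h2 w; have two_rows v i : 0 <= v <= N - 1 ->
    E <= row_hits s (w + Ln + v + i * n) + row_hits s (w + Ln + v + 1 + i * n) ->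
    E <= zsum (row_hits s) (w + Ln) (Z.to_nat (n - Ln)).
  move=> vN; rewrite !row_hits_per => hv.
  have -> : Z.to_nat (n - Ln) = (Z.to_nat v + (2 + Z.to_nat (n - Ln - v - 2)))%nat.
    by rewrite -!plusE; lia.
  rewrite !zsum_cat Z2Nat.id /=; last lia.
  have := zsum_hits_ge0 s (w + Ln) (Z.to_nat v).
  by have := zsum_hits_ge0 s (w + Ln + v + 2) (Z.to_nat (n - Ln - v - 2)); lia.
have rb := Z.mod_pos_bound (p - w) n; have rE := Z_div_mod_eq_full (p - w) n.
set r := (p - w) mod n in rb rE; set q := (p - w) / n in rE.
case: (Z_le_gt_dec r (N - 2)) => r1.
  apply: (two_rows (r + 1) q); first lia.
  have -> : w + Ln + (r + 1) + q * n = p + N by lia.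
  by have -> : w + Ln + (r + 1) + 1 + q * n = p + N + 1 by lia.
case: (Z_le_gt_dec r (n - 2)) => r2.
  apply: (two_rows (r - Ln) q); first lia.
  have -> : w + Ln + (r - Ln) + q * n = p by lia.
  by have -> : w + Ln + (r - Ln) + 1 + q * n = p + 1 by lia.
apply: (two_rows 0 (q + 1)); first lia.
have -> : w + Ln + 0 + (q + 1) * n = p + N by lia.
by have -> : w + Ln + 0 + 1 + (q + 1) * n = p + N + 1 by lia.
Qed.

(** The step into the next row is unsafe only if the cop is close in front ([blocked]). The robber
    then runs sideways; if the cop blocks every time, the whole row gets damaged. *)
Lemma next_row s tg : tg = 1 \/ tg = -1 -> exists s', le s s' /\
  (ry s' = ry s /\ row_hits s' (ry s) = m \/ ry s' = ry s + tg).
Proof.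
move=> tg1; have [sg [tg0 [d [a0 [off0 [d0 [dm [a00 a0n]]]]]]]] := offset_ex s.
have [a [off an]] : exists a, offset sg tg s d a /\ 0 <= a < n.
  have h : tg = tg0 \/ tg = - tg0 by case: off0 => _ [tg01 _]; lia.
  case: h => ->; first by exists a0; split=> //; lia.
  case: (Z.eq_dec a0 0) => [aE|aN].
    by exists (- a0); split; [exact: offset_flipy | lia].
  exists (n - a0); split; last lia.
  have := offset_shift _ _ _ _ _ 0 1 (offset_flipy _ _ _ _ _ off0).
  by rewrite Z.mul_0_l Z.add_0_r; have -> : - a0 + 1 * n = n - a0 by lia.
pose up_safe d a := 2 <= circ m d + circ n (a - 1).
have cn_m1 : circ n (0 - 1) = 1 by rewrite -circ_opp ?cn_small; lia.
have blocked d' a' s' : offset sg tg s' d' a' -> 0 <= d' <= 3 \/ 0 <= d' <= m - d' ->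
    -1 <= a' <= 3 \/ 0 <= a' < n -> ~ up_safe d' a' -> 0 <= d' <= 1 /\ 1 <= a' <= 2.
  move=> off' hd ha; rewrite /up_safe => h.
  have := offset_apart _ _ _ _ _ off'; have := cm_small d'; have := cn_small (a' - 1).
  have := cn_ge0 (a' - 1); have := cn_small 0.
  case: (Z.eq_dec a' 0) => [aE|aN]; first by subst a'; lia.
  case: (Z.eq_dec a' (-1)) => [aE|aN']; last by lia.
  have : circ n (-1 - 1) = Z.min 2 (n - 2) by rewrite -circ_opp ?cn_small; lia.
  by subst a'; lia.
have [|||s1 [i [d1 [a1 [ss1 ry1 off1 seg [i0 [Pi h]]]]]]] := run_away
  (fun _ d a => up_safe d a \/ 0 <= d <= 1 /\ 1 <= a <= 2) (fun _ _ d a => up_safe d a)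
  off _ _ (m - 1).
- by case: (classic (up_safe d a)) => us; [left | right; apply: blocked off _ _ us; lia].
- move=> s' j d' a' off' _ _ _ [us|Pj]; [by left | right].
  have := cm_small (d' + 1); have := cn_small a' => h1 h2; split; first lia.
  move=> d'' a'' [st _] s'' off'' _; case: (classic (up_safe d'' a'')) => us; first by left.
  by right; apply: blocked off'' _ _ us; lia.
- by lia.
case: h => [[_ us]|iE]; last first.
  exists s1; split=> //; left; split=> //; rewrite -ry1.
  by apply: row_seg_full seg; [case: off1 | lia].
have [s2 [d2 [a2 [ss2 _ ry2 _ _]]]] := move_up off1 us.
by exists s2; split; [exact: le_trans ss2 | right; lia].
Qed.

(** Climb, sweep, enter the next row, sweep again: this yields [2L >= E] hits, or a full row with
    [m >= E]. *)
Lemma far_rows (k : nat) {s sg tg d a} : offset sg tg s d a -> 1 <= a <= n ->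
  2 * Z.of_nat k <= a + circ m d - 1 -> exists2 s', le s s' &
  E <= row_hits s' (ry s + tg * Z.of_nat k) + row_hits s' (ry s + tg * Z.of_nat k + tg).
Proof.
move=> off an hk; have tg1 : tg = 1 \/ tg = -1 by case: off => _ [].
have [s1 ss1 ry1] := climb k off an hk; have [s2 [ss2 ry2 h2]] := sweep s1.
have [s3 [ss3 h3]] := next_row s2 tg tg1.
have hL := row_hits_le _ _ (ry s1) ss3.
have ss3' := le_trans _ _ _ ss1 (le_trans _ _ _ ss2 ss3).
rewrite -ry1; case: h3 => [[ry3 h3]|ry3].
  exists s3 => //; rewrite -ry2 h3; have := row_hits_ge0 s3 (ry s2 + tg); lia.
have [s4 [ss4 ry4 h4]] := sweep s3; exists s4; first exact: le_trans ss4.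
have -> : ry s1 + tg = ry s3 by lia.
by have := row_hits_le _ _ (ry s1) ss4; lia.
Qed.

(** The robber flees from the cop's row. If row [ry s + tf] lies on the cop's side, the opposite
    pair begins after [N - 1] rows; otherwise it begins after [N] rows, which needs [a < circ m d].
    If [a = N], the cop counts as being on either side; a full row suffices alone, so its partner
    may be taken on the cop's side. *)
Lemma spread_from s sg tg tf d a : offset sg tg s d a -> 0 <= a -> 2 * a <= n ->
  a <= circ m d -> 1 <= circ m d -> tf = 1 \/ tf = -1 ->
  E <= row_hits s (ry s) + row_hits s (ry s + tf) ->
  row_hits s (ry s) = m \/ a = N \/ a < circ m d -> exists s', spread s'.
Proof.
move=> off a0 an ad d1 tf1 hE h.
have tg1 : tg = 1 \/ tg = -1 by case: off => _ [].
have away_from t a' : offset sg t s d a' -> 0 <= a' -> 2 * a' <= n -> a' <= circ m d ->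
    E <= row_hits s (ry s) + row_hits s (ry s + t) -> exists s', spread s'.
  move=> off' a'0 a'n a'd hE'; have t1 : t = 1 \/ t = -1 by case: off' => _ [].
  have := offset_shift _ _ _ _ _ 0 1 (offset_flipy _ _ _ _ _ off').
  rewrite Z.mul_0_l Z.add_0_r => off2.
  have [||s' ss' h'] := far_rows (Z.to_nat (N - 1)) off2; try lia.
  rewrite Z2Nat.id in h'; last lia.
  exists s'; have hle y := row_hits_le _ _ y ss'.
  have := hle (ry s); have := hle (ry s + t).
  case: t1 hE' h' {off' off2} => -> hE' h' h1 h2.
    apply: (spread_four_rows _ (ry s)); first lia.
    rewrite -(row_hits_per _ (ry s + N) (-1)) -(row_hits_per _ (ry s + N + 1) (-1)).
    have -> : ry s + N + -1 * n = ry s + - (1) * (N - 1) + - (1) by lia.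
    have -> : ry s + N + 1 + -1 * n = ry s + - (1) * (N - 1) by lia.
    by lia.
  apply: (spread_four_rows _ (ry s - 1)).
    have -> : ry s - 1 + 1 = ry s by lia.
    have -> : ry s - 1 = ry s + -1 by lia.
    by lia.
  have -> : ry s - 1 + N = ry s + - (-1) * (N - 1) by lia.
  have -> : ry s + - (-1) * (N - 1) + 1 = ry s + - (-1) * (N - 1) + - (-1) by lia.
  by [].
case: (Z.eq_dec (row_hits s (ry s)) m) => [full|nfull].
  by apply: (away_from tg a) => //; have := row_hits_ge0 s (ry s + tg); lia.
case: (Z.eq_dec tf tg) => [tfE|tfN].
  by subst tf; apply: (away_from tg a).
case: (Z.eq_dec a N) => [aN|ne].
  apply: (away_from tf N) => //; try lia.
  have -> : tf = - tg by lia.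
  have := offset_shift _ _ _ _ _ 0 1 (offset_flipy _ _ _ _ _ off).
  by rewrite Z.mul_0_l Z.add_0_r; have -> : - a + 1 * n = N by lia.
have tfE : tf = - tg by lia.
have := offset_shift _ _ _ _ _ 0 1 (offset_flipy _ _ _ _ _ off).
rewrite Z.mul_0_l Z.add_0_r -tfE => off2.
have [||s' ss' h'] := far_rows (Z.to_nat N) off2; try lia.
rewrite Z2Nat.id in h'; last lia.
exists s'; have hle y := row_hits_le _ _ y ss'.
have := hle (ry s); have := hle (ry s + tf).
case: tf1 hE h' {tfE tfN off2} => -> hE h' h1 h2.
  apply: (spread_four_rows _ (ry s)); first lia.
  have -> : ry s + N = ry s + 1 * N by lia.
  by [].
apply: (spread_four_rows _ (ry s - 1)).
  have -> : ry s - 1 + 1 = ry s by lia.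
  have -> : ry s - 1 = ry s + -1 by lia.
  by lia.
rewrite -(row_hits_per _ (ry s - 1 + N) (-1)) -(row_hits_per _ (ry s - 1 + N + 1) (-1)).
have -> : ry s - 1 + N + -1 * n = ry s + -1 * N + -1 by lia.
have -> : ry s - 1 + N + 1 + -1 * n = ry s + -1 * N by lia.
by lia.
Qed.
(** After each [loop] the row is full, or [a < circ m d], or the cop is on the diagonal again, one
    step further out. The last case ends at [t = N], with the cop in the opposite row. *)
Lemma leave_diagonal (k : nat) s sg tg t : offset sg tg s t t -> 1 <= t ->
  t + Z.of_nat k = N -> exists s' sg' tg' d a, [/\ le s s', ry s' = ry s,
    offset sg' tg' s' d a, 0 <= a & 2 * a <= n] /\
    [/\ a <= circ m d, 1 <= circ m d & row_hits s' (ry s') = m \/ a = N \/ a < circ m d].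
Proof.
elim: k s tg t => [|k IH] s tg t off t1 tN.
  exists s, sg, tg, t, t; rewrite cm_small; last lia.
  by split; [split=> //; lia | split; lia].
have [|s1 [d [a [ss1 ry1 off1 [[dE aE full]|[[st [st1 st2]] ne]]]]]] := loop off.
- by rewrite cm_small ?cn_small; lia.
- subst d a; exists s1, sg, tg, t, t; rewrite cm_small; last lia.
  by split; [split=> //; lia | split; try lia; left].
have [tg' [a' [off' a'0 a'n aE]]] := vertical_canon off1.
rewrite (cn_small t) in st2; last lia.
have ha : circ n a = a by rewrite cn_small; lia.
case: (Z.eq_dec d a) => [da|da].
  have aE' : a = t + 1 by lia.
  have d'E : d = a' by lia.
  rewrite d'E in off'.
  have [||s2 [sg2 [tg2 [d2 [a2 [[ss2 ry2 off2 a20 a2n] h]]]]]] := IH _ _ _ off'; try lia.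
  by exists s2, sg2, tg2, d2, a2; split=> //; split=> //; [exact: le_trans ss2 | lia].
exists s1, sg, tg', d, a'; have := cm_small d.
by split; [split=> //; lia | split; [ | | right; right]; lia].
Qed.

(* A run of L - N steps stays in the cone; at its end either d > A and
   m - d > A, or the cop is in the opposite row, or d = A. *)
Lemma spread_run s sg tg tf d a : offset sg tg s d a -> tf = 1 \/ tf = -1 ->
  L <= row_hits s (ry s + tf) -> 1 <= d -> circ n a <= d -> d - circ n a <= 4 ->
  d + circ n a <= 2 * N \/ d + circ n a <= 2 * N + 1 /\ circ n a = N ->
  exists s', spread s'.
Proof.
move=> off tf1 hL d1 ad da sum_d.
(* A run of [L - N] steps damages [L - N + 1] vertices; with the [L] hits of the other row this
   makes at least [E]. *)
have [|||s4 [i [d4 [a4 [ss4 ry4 off4 seg [i0 [[P1 [P2 [P3 P4]]] h]]]]]]] := run_away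
  (fun i d a => 1 <= d /\ circ n a <= d /\ d - circ n a <= 4 + 2 * i /\
    (d + circ n a <= 2 * N + 2 * i \/ d + circ n a <= 2 * N + 1 + 2 * i /\ circ n a = N))
  (fun _ i _ _ => L - N <= i) off _ _ (L - N).
- by lia.
- move=> {off hL d1 ad da sum_d tf1} s' j d' a' _ _ _ j0 [P1 [P2 [P3 P4]]].
  case: (Z_le_gt_dec (L - N) j) => jL; [by left | right].
  have A0 := cn_ge0 a'; have d'm : d' + 3 <= m by lia.
  split; first by rewrite cm_small; lia.
  move=> d'' a'' [st [_ st2]] _ _ _; have A''n := cn_le a''.
  by clear L_half Ln_half E_def E_le; lia.
- by lia.
have iE : i = L - N by lia.
subst i; have [tg4 [a4' [off4' a40 a4n aE4]]] := vertical_canon off4.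
rewrite aE4 in P2 P3 P4.
have x_row : L - N + 1 <= row_hits s4 (ry s4).
  by apply: row_seg_long seg; [case: off4 | lia | lia].
have hE : E <= row_hits s4 (ry s4) + row_hits s4 (ry s4 + tf).
  by have := row_hits_le _ _ (ry s + tf) ss4; rewrite ry4 in x_row *; lia.
case: (Z.eq_dec d4 a4') => [dE|dN]; last first.
  have hD := cm_small d4.
  by apply: (spread_from _ _ _ _ _ _ off4' _ _ _ _ tf1 hE); lia.
subst d4; have [|s5 [sg5 [tg5 [d5 [a5 [[ss5 ry5 off5 a50 a5n] [w1 w2 w3]]]]]]] :=
  leave_diagonal (Z.to_nat (N - a4')) _ _ _ _ off4' P1; first lia.
apply: (spread_from _ _ _ _ _ _ off5 a50 a5n w1 w2 tf1 _ w3).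
by rewrite ry5; have := row_hits_le _ _ (ry s4) ss5;
  have := row_hits_le _ _ (ry s4 + tf) ss5; lia.
Qed.

Lemma spread_full_row s sg tg d a : offset sg tg s d a -> circ n a <= circ m d ->
  1 <= circ m d -> row_hits s (ry s) = m -> exists s', spread s'.
Proof.
move=> off ad d1 full; have [tg' [a' [off' a'0 a'n aE]]] := vertical_canon off.
rewrite aE in ad; apply: (spread_from _ _ _ tg' _ _ off') => //.
- by case: off' => _ [].
- by have := row_hits_ge0 s (ry s + tg'); lia.
- by left.
Qed.

(* If d + A = 2N + 1 and the cop is not in the opposite row, then he stands at
   offset (N + 2, N - 1), and the robber walks towards him. *)
Lemma spread_entering_row s sg tg tf d a : offset sg tg s d a -> tf = 1 \/ tf = -1 ->
  L <= row_hits s (ry s + tf) -> 1 <= d -> circ n a <= d -> d - circ n a <= 4 ->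
  d + circ n a <= 2 * N + 1 -> exists s', spread s'.
Proof.
move=> off tf1 hL d1 ad da sum_d; have An := cn_le a; have A0 := cn_ge0 a.
case: (Z_le_gt_dec (d + circ n a) (2 * N)) => S2.
  by apply: spread_run off tf1 hL d1 ad da _; left.
case: (Z.eq_dec (circ n a) N) => AN.
  by apply: spread_run off tf1 hL d1 ad da _; right.
have dE : d = N + 2 by lia.
have [|s3 [d3 [a3 [ss3 ry3 off3 h]]]] := loop (offset_flipx _ _ _ _ _ off).
  by have := cm_neg (- d + 1); lia.
case: h => [[d3E a3E full]|[[st3 [_ st4]] ne]].
  by apply: spread_full_row off3 _ _ full; subst d3 a3; rewrite cm_neg; lia.
have := offset_flipx _ _ _ _ _ off3; rewrite Z.opp_involutive => off3'.
have A3n := cn_le a3; rewrite -ry3 in hL.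
apply: (spread_run _ _ _ _ _ _ off3' tf1); try lia.
by have := row_hits_le _ _ (ry s3 + tf) ss3; lia.
Qed.

(** A step towards the cop's row leaves the row with [L] hits behind the robber. The bounds on
    [d + a] and [d - a] allow for the cop's answer before [spread_entering_row] applies. *)
Lemma spread_approach s sg tg d a : offset sg tg s d a -> L <= row_hits s (ry s) ->
  0 <= a -> 2 * a <= n -> 2 <= d -> a <= d ->
  (1 <= a -> d + a <= 2 * N + 1 /\ d - a <= 2) -> (a = 0 -> d <= 3) ->
  exists s', spread s'.
Proof.
move=> off hL a0 an d2 ad b1 b2; have dN : d <= N + 1 by lia.
have cn_a : circ n (a - 1) = Z.abs (a - 1).
  case: (Z.eq_dec a 0) => [->|aN]; last by rewrite cn_small; lia.
  by rewrite -circ_opp ?cn_small; lia.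
have [|s2 [d2' [a2 [ss2 _ ry2 off2 [st [_ st2]]]]]] := move_up off.
  by have := cm_small d; have := cn_ge0 (a - 1); lia.
rewrite cn_a in st2; have A2n := cn_le a2; have A20 := cn_ge0 a2.
have hL2 : L <= row_hits s2 (ry s2 + - tg).
  have -> : ry s2 + - tg = ry s by lia.
  by have := row_hits_le _ _ (ry s) ss2; lia.
have tf1 : - tg = 1 \/ - tg = -1 by case: off => _ [] ? _; lia.
by apply: spread_entering_row off2 tf1 hL2 _ _ _ _; lia.
Qed.

Lemma spread_even : exists s, spread s.
Proof.
have [s [sg [tg [d [a [[off a0 an ad d1] [hL h]]]]]]] := first_row.
case: h => [full|[d0 dm ad' amd dlim]].
  by apply: spread_full_row off _ _ full; rewrite ?cn_small; lia.
case: (Z.eq_dec d 1) => [dE|dN]; last by apply: spread_approach off hL _ _ _ _ _ _; lia.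
(* The cop's row cannot be approached from the corner (1, 1). *)
subst d; have [|s1 [d [a1 [ss1 ry1 off1 [[dE aE full]|[[st [st1 st2]] ne]]]]]] := loop off.
- by have := cm_small (1 + 1); have := cn_ge0 a; lia.
- by subst d a1; apply: spread_full_row off1 _ _ full; rewrite ?cn_small; lia.
have [tg' [a' [off' a'0 a'n aE]]] := vertical_canon off1.
rewrite (cn_small a) in st2; last lia.
have hL1 : L <= row_hits s1 (ry s1) by have := row_hits_le _ _ (ry s) ss1; rewrite ry1; lia.
by apply: spread_approach off' hL1 _ _ _ _ _ _; lia.
Qed.
End EvenHeight.
Lemma spread_hits : (exists s, spread s) -> exists s : state A, n * L <= hits s.
Proof.
case=> s sp; have [s' ss' cl] := closed_ex s.
by exists s'; apply: closed_hits cl (spread_le _ _ ss' sp).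
Qed.
End Arena.

Arguments state {m n} A : rename.
Arguments rx {m n A} s : rename.
Arguments ry {m n A} s : rename.
Arguments cx {m n A} s : rename.
Arguments cy {m n A} s : rename.
Arguments hit {m n A} s x y : rename.
Arguments row_hits {m n A} s y : rename.
Arguments hits {m n A} s : rename.

Section ManyHits.
Local Open Scope Z_scope.

Lemma many_hits {m n : Z} (A : arena m n) (L : Z) : 4 <= m -> 4 <= n -> 1 <= L ->
  2 * L + 1 <= m -> exists s : state A, n * L <= hits s.
Proof.
move=> m4 n4 L1 Lm; have [Ln hLn] := half_ex (n - 1).
have [E hE] : exists E, E = n * L - Ln * m by exists (n * L - Ln * m).
have LnE : Ln * (2 * L + 1) <= Ln * m by apply: Z.mul_le_mono_nonneg_l; lia.
case: (Z_le_gt_dec E L) => EL.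
  apply: (spread_hits A m4 n4 L L1 Lm Ln E); try lia.
  by apply: (spread_pair A m4 n4 L L1 Lm); lia.
(* For odd [n] the definition of [E] gives [E <= L - Ln], so [E > L] occurs only for even [n]. *)
have [N nN] : exists N, n = 2 * N.
  case: (Z.eq_dec n (2 * Ln + 1)) => nE; last by exists (Ln + 1); lia.
  by exfalso; rewrite nE in hE; lia.
have LnN : Ln = N - 1 by lia.
have EN : E <= 2 * L + 1 - N by rewrite LnN nN in LnE hE; lia.
apply: (spread_hits A m4 n4 L L1 Lm Ln E); try lia.
by apply: (spread_even A m4 n4 L L1 Lm Ln E _ N); lia.
Qed.

End ManyHits.

(** * The damage game *)

Section GameValue.
Variable G : sgraph.

Lemma dmg_le (sigma : cop_strategy G) B : cop_legal sigma ->
  (forall tau, robber_legal tau -> damage sigma tau <= B) -> dmg G <= B.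
Proof.
move=> sL hB; have bigmin_le (r : seq 'I_#|G|.+1) (P : pred 'I_#|G|.+1) i :
    i \in r -> P i -> \big[minn/#|G|]_(d <- r | P d) d <= i.
  elim: r => // j r IH; rewrite inE big_cons => /orP[/eqP->|ir] Pi.
    by rewrite Pi geq_minl.
  by case: ifP => _; rewrite ?geq_min IH ?orbT.
have mdG : max_damage sigma < #|G|.+1 by rewrite ltnS; apply/bigmax_leqP => d _; rewrite -ltnS.
apply: (@leq_trans (Ordinal mdG)).
  by apply: bigmin_le; [rewrite mem_index_enum | apply/asboolP; exists sigma].
by apply/bigmax_leqP => d /asboolP[tau [tL <-]]; apply: hB.
Qed.

Lemma dmg_ge B : B <= #|G| -> (forall sigma : cop_strategy G, cop_legal sigma ->
  exists2 tau, robber_legal tau & B <= damage sigma tau) -> B <= dmg G.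
Proof.
move=> BG hB; rewrite /dmg; elim/big_ind: _ => // [x y|d /asboolP[sigma [sL <-]]].
  by rewrite leq_min => -> ->.
have [tau tL Bd] := hB _ sL; apply: leq_trans Bd _.
have dG : damage sigma tau < #|G|.+1 by rewrite ltnS max_card.
by apply: (leq_bigmax_cond (Ordinal dG)); apply/asboolP; exists tau.
Qed.

End GameValue.

(** * Lifting the vertices of a cycle to the integers *)

Section Projection.
Local Open Scope Z_scope.
Variable k : nat.
Let K := Z.of_nat k.+1.

Definition proj (z : Z) : 'I_k.+1 := inord (Z.to_nat (z mod K)).

Lemma proj_val z : Z.of_nat (proj z) = z mod K.
Proof.
have zb : 0 <= z mod K < K by apply: Z.mod_pos_bound; rewrite /K; lia.
rewrite inordK; first lia.
by apply/ltP; rewrite /K in zb *; lia.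
Qed.

Lemma proj_ord (i : 'I_k.+1) : proj (Z.of_nat i) = i.
Proof.
apply: val_inj; apply: Nat2Z.inj; rewrite proj_val Z.mod_small //.
by have /ltP := ltn_ord i; rewrite /K; lia.
Qed.

Lemma proj_eq z w : proj z = proj w <-> exists i, z = w + i * K.
Proof.
split=> [/(congr1 (fun i : 'I__ => Z.of_nat i))|[i ->]].
  rewrite !proj_val => zw; exists (z / K - w / K).
  have := Z_div_mod_eq_full z K; have := Z_div_mod_eq_full w K; lia.
by rewrite /proj Z_mod_plus_full.
Qed.

Lemma proj_succ z : ordS (proj z) = proj (z + 1).
Proof.
apply: val_inj; apply: Nat2Z.inj; rewrite proj_val /=.
have zb : 0 <= z mod K < K by apply: Z.mod_pos_bound; rewrite /K; lia.
have pz := proj_val z; rewrite -Z.add_mod_idemp_l -?pz; last by rewrite /K; lia.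
have /ltP pk := ltn_ord (proj z).
case: (ltnP (proj z).+1 k.+1) => [h|h].
  by rewrite modn_small // Z.mod_small; move/ltP: h; rewrite /K; lia.
have -> : (proj z).+1 = k.+1 by move/leP: h; lia.
rewrite modnn; have -> : Z.of_nat (proj z) + 1 = K by move/leP: h; rewrite /K; lia.
by rewrite Z_mod_same_full.
Qed.

Lemma proj_legal z w : Z.abs (w - z) <= 1 ->
  @legal_move (cycle_graph k.+1) (proj z) (proj w).
Proof.
move=> zw; rewrite /legal_move; case: eqP => //= ne; rewrite /cycle_adj.
have -> /= : proj z != proj w by apply/eqP.
have [wE|[wE|wE]] : w = z \/ w = z + 1 \/ z = w + 1 by lia.
- by rewrite wE in ne.
- by rewrite !proj_succ wE eqxx.
- by rewrite !proj_succ wE eqxx orbT.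
Qed.

Lemma legal_proj z v : @legal_move (cycle_graph k.+1) (proj z) v ->
  exists2 e, Z.abs e <= 1 & v = proj (z + e).
Proof.
rewrite /legal_move => /orP[/eqP<-|]; first by exists 0; rewrite ?Z.add_0_r.
move=> /andP[_ /orP[/eqP<-|/eqP zv]]; first by exists 1 => //; rewrite proj_succ.
exists (-1) => //; rewrite -(proj_ord v) in zv *; move: zv; rewrite proj_succ.
by move=> /proj_eq[i h]; apply/proj_eq; exists i; lia.
Qed.

End Projection.

Lemma playS {G : sgraph} (sigma : cop_strategy G) tau i :
  play sigma tau i.+1 = rcons (play sigma tau i) (cop_at sigma tau i, robber_at sigma tau i).
Proof. by []. Qed.

(** * The upper bound on a cycle *)

Section CycleDamage.
Local Open Scope Z_scope.
Variable k : nat.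
Local Notation C := (cycle_graph k.+1).
Let K := Z.of_nat k.+1.

(* The cop answers the robber's position r by 2a - r, where a is chosen so that
   this can be reached in the first round. *)
Definition mirror_cop : cop_strategy C := fun h =>
  if h is (c0, r0) :: h' then
    let cr := last (c0, r0) h' in
    let t := proj k (2 * Z.of_nat (uphalf (r0 : 'I_k.+1)) - Z.of_nat (cr.2 : 'I_k.+1)) in
    if @legal_move C cr.1 t then t else cr.1
  else ord0.

Lemma mirror_cop_legal : cop_legal mirror_cop.
Proof.
move=> h c r; rewrite /mirror_cop; case: h => [|[c0 r0] h] /=; rewrite ?last_rcons /=;
  by case: ifP => // _; rewrite /legal_move eqxx.
Qed.

Section Play.
Variable tau : robber_strategy C.
Hypothesis tau_legal : robber_legal tau.
Let a := Z.of_nat (uphalf (robber_at mirror_cop tau 0 : 'I_k.+1)).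

Lemma mirror_cop_at i :
  let t := proj k (2 * a - Z.of_nat (robber_at mirror_cop tau i : 'I_k.+1)) in
  cop_at mirror_cop tau i.+1 = if @legal_move C (cop_at mirror_cop tau i) t then t
                               else cop_at mirror_cop tau i.
Proof.
have headE j : exists h, play mirror_cop tau j.+1 =
    (cop_at mirror_cop tau 0, robber_at mirror_cop tau 0) :: h.
  by elim: j => [|j [h hE]]; [exists [::] | rewrite playS hE; eexists].
move=> t; have [h hE] := headE i; rewrite [LHS]/cop_at hE.
have := playS mirror_cop tau i.
rewrite hE => /(congr1 (last (cop_at mirror_cop tau i, robber_at mirror_cop tau i))).
by rewrite last_rcons /= => lastE; rewrite /mirror_cop lastE.
Qed.

Variable L : nat.
Hypothesis L_half : 2 * Z.of_nat L + 1 <= K <= 2 * Z.of_nat L + 2.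

(** The reflection fixes [a]; opposite to it, it fixes a vertex or swaps the ends of an edge,
    according to the parity of [K]. The robber cannot pass either place uncaptured, so he stays in
    the [L] vertices between them. *)
Lemma mirror_confines i : uncaptured_at_turn mirror_cop tau i -> exists e : Z,
  [/\ 1 <= e <= Z.of_nat L, robber_at mirror_cop tau i = proj k (a + e) &
      cop_at mirror_cop tau i.+1 = proj k (a - e)].
Proof.
have half : K = 2 * Z.of_nat L + 1 \/ K = 2 * Z.of_nat L + 2 by lia.
elim: i => [|i IH] unc.
  have [c0 c1] := unc 0%nat (leqnn _).
  have r0 := proj_ord k (robber_at mirror_cop tau 0).
  have /ltP r0k := ltn_ord (robber_at mirror_cop tau 0 : 'I_k.+1).
  (* By the rounding in [uphalf], the mirror image [2a - r] of the robber's first vertex is 0 or 1,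
     within reach of the cop at 0. *)
  have [b aE] : exists b : bool, 2 * a = Z.of_nat (robber_at mirror_cop tau 0 : 'I_k.+1) + Z.b2z b.
    rewrite /a; move: (nat_of_ord _) => r; exists (odd r).
    have := odd_double_half r; rewrite uphalf_half -addnn -!plusE.
    by case: (odd r); rewrite [nat_of_bool _]/= [Z.b2z _]/=; lia.
  have b01 : 0 <= Z.b2z b <= 1 by case: b {aE} => /=; lia.
  set r := (robber_at mirror_cop tau 0 : 'I_k.+1) in c0 c1 r0 r0k aE *.
  have rN0 : Z.of_nat r <> 0.
    move=> rE; move/eqP: c0; rewrite -[RHS]r0 rE; apply.
    by rewrite -[LHS]proj_ord.
  have c1E : cop_at mirror_cop tau 1 = proj k (a - (Z.of_nat r - a)).
    rewrite mirror_cop_at -/r -/a.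
    have -> : 2 * a - Z.of_nat r = a - (Z.of_nat r - a) by lia.
    have -> : cop_at mirror_cop tau 0 = proj k 0 by rewrite -[LHS]proj_ord.
    by rewrite proj_legal //; lia.
  exists (Z.of_nat r - a); split=> //.
    split; last by rewrite /K in half; lia.
    suff : Z.of_nat r <> 1 by lia.
    by move=> r1; move/eqP: c1; rewrite c1E => -[]; rewrite -[RHS]r0; congr proj; lia.
  by rewrite -[LHS]r0; congr proj; lia.
have [e [e1 rE cE]] : exists e : Z,
  [/\ 1 <= e <= Z.of_nat L, robber_at mirror_cop tau i = proj k (a + e) &
      cop_at mirror_cop tau i.+1 = proj k (a - e)].
  by apply: IH => j ji; apply: unc; apply: leqW.
have [c0 c1] := unc i.+1 (leqnn _).
have := tau_legal (play mirror_cop tau i) (cop_at mirror_cop tau i)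
  (robber_at mirror_cop tau i) (cop_at mirror_cop tau i.+1).
rewrite -playS -/(robber_at mirror_cop tau i.+1) rE => /legal_proj[h h1 rE'].
have cE' : cop_at mirror_cop tau i.+2 = proj k (a - (e + h)).
  rewrite mirror_cop_at cE.
  have -> : proj k (2 * a - Z.of_nat (robber_at mirror_cop tau i.+1 : 'I_k.+1)) = proj k (a - (e + h)).
    rewrite rE' proj_val; apply/proj_eq; exists ((a + e + h) / K).
    by have := Z_div_mod_eq_full (a + e + h) K; rewrite /K; lia.
  by rewrite proj_legal //; lia.
exists (e + h); split; [ | by rewrite rE'; congr proj; lia | exact: cE'].
have e0 : e + h <> 0.
  by move=> e0; move/eqP: c1; rewrite cE' rE'; apply; congr proj; lia.
case: (Z.eq_dec (e + h) (Z.of_nat L + 1)) => [eL|]; last by lia.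
case: half => KE.
  move/eqP: c0; rewrite cE rE' => -[]; apply/proj_eq; exists (-1).
  by rewrite -/K KE; lia.
move/eqP: c1; rewrite cE' rE' => -[]; apply/proj_eq; exists (-1).
by rewrite -/K KE; lia.
Qed.

Lemma mirror_damage : (damage mirror_cop tau <= L)%nat.
Proof.
pose D := [set proj k (a + Z.of_nat e.+1) | e : 'I_L].
have sub : [set v | `[< damaged mirror_cop tau v >]] \subset D.
  apply/subsetP => v; rewrite inE => /asboolP[i [<- /mirror_confines[e [e1 -> _]]]].
  have eL : (Z.to_nat (e - 1) < L)%nat by apply/ltP; lia.
  apply/imsetP; exists (Ordinal eL) => //=; congr proj; lia.
apply: leq_trans (subset_leq_card sub) _.
by apply: leq_trans (leq_imset_card _ _) _; rewrite card_ord.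
Qed.

End Play.

Lemma dmg_cycle (L : nat) : 2 * Z.of_nat L + 1 <= K <= 2 * Z.of_nat L + 2 ->
  (dmg C <= L)%nat.
Proof.
move=> hL; apply: (dmg_le _ mirror_cop) mirror_cop_legal _ => tau tau_legal.
exact: mirror_damage.
Qed.

End CycleDamage.

(** * From a finite play to a robber strategy *)

Section Replay.
Variables (G : sgraph) (sigma : cop_strategy G) (d : G * G).

(* Finite plays at whose end the robber is to move and has not been captured. *)
Definition live (h : history G) := forall i, i < size h ->
  [/\ nth d h i = (sigma (take i h), (nth d h i).2),
      sigma (take i h) != (nth d h i).2, sigma (take i.+1 h) != (nth d h i).2 &
      0 < i -> legal_move (nth d h i.-1).2 (nth d h i).2].

Lemma live_rcons h r : live h -> sigma h != r -> sigma (rcons h (sigma h, r)) != r ->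
  (0 < size h -> legal_move (last d h).2 r) -> live (rcons h (sigma h, r)).
Proof.
move=> lh c0 c1 rr i; rewrite size_rcons ltnS leq_eqVlt => /orP[/eqP->|ih].
  rewrite nth_rcons ltnn eqxx -cats1 take_size_cat //.
  rewrite take_oversize ?size_cat ?addn1 // cats1; split=> // h0.
  by rewrite nth_rcons prednK // leqnn nth_last; apply: rr.
have [h1 h2 h3 h4] := lh i ih.
have ih1 : i.-1 < size h by apply: leq_ltn_trans (leq_pred i) ih.
by rewrite -cats1 !takel_cat ?(ltnW ih) // !nth_cat ih ih1.
Qed.

(** The robber repeats his moves in [p] whatever the cop does. Staying put when the recorded move is
    illegal makes the strategy legal on every history. *)
Definition replay (p : history G) : robber_strategy G := fun h _ =>
  let t := (nth d p (size h)).2 in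
  if 0 < size h then if legal_move (last d h).2 t then t else (last d h).2 else t.

Lemma replay_legal p : robber_legal (replay p).
Proof.
move=> h c r c'; rewrite /replay size_rcons last_rcons /=.
by case: ifP => // _; rewrite /legal_move eqxx.
Qed.

Variable h : history G.
Hypothesis h_live : live h.

Lemma replay_take i c : i < size h -> replay h (take i h) c = (nth d h i).2.
Proof.
move=> ih; have [_ _ _ leg] := h_live i ih.
rewrite /replay size_take ih; case: ifP => // i0.
rewrite -nth_last size_take ih nth_take ?prednK //.
by rewrite leg.
Qed.

Lemma play_replay i : i <= size h -> play sigma (replay h) i = take i h.
Proof.
elim: i => [|i IH] ih; first by rewrite take0.
rewrite playS /robber_at /cop_at IH; last exact: ltnW.
by rewrite replay_take // (take_nth d) //; have [-> _ _ _] := h_live i ih.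
Qed.

(** The last vertex counts too, because [live] also demands that the cop's next move is no
    capture. *)
Lemma damage_replay : #|[set v in map snd h]| <= damage sigma (replay h).
Proof.
apply/subset_leq_card/subsetP => v; rewrite !inE => /(nthP d.2)[i].
rewrite size_map => ih; rewrite (nth_map d) // => <-; apply/asboolP.
have rob_at j : j < size h -> robber_at sigma (replay h) j = (nth d h j).2.
  by move=> jh; rewrite /robber_at play_replay ?replay_take // ltnW.
exists i; split=> [|j ji]; first exact: rob_at.
have jh := leq_ltn_trans ji ih; have [_ h1 h2 _] := h_live j jh.
by rewrite rob_at // /cop_at !play_replay // ltnW.
Qed.

End Replay.

Lemma zsum_add F F' b k :
  (zsum (fun i => F i + F' i) b k = zsum F b k + zsum F' b k)%Z.
Proof. by elim: k b => [|k IH] b //=; rewrite IH; lia. Qed.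

Lemma zsum_exchange (F : Z -> Z -> Z) a b k l :
  zsum (fun y => zsum (fun x => F x y) a k) b l =
  zsum (fun x => zsum (fun y => F x y) b l) a k.
Proof.
elim: l b => [|l IH] b /=; first by elim: k a => [|k IH] a //=; rewrite -IH.
by rewrite zsum_add IH.
Qed.

Lemma zsum_nat F (f : nat -> nat) b k : (forall i, F (b + Z.of_nat i)%Z = Z.of_nat (f i)) ->
  zsum F b k = Z.of_nat (\sum_(i < k) f i).
Proof.
elim: k b f => [|k IH] b f fE; first by rewrite big_ord0.
rewrite big_ord_recl /= -plusE Nat2Z.inj_add -fE Z.add_0_r; congr Z.add.
by apply: (IH (b + 1)%Z (fun i => f i.+1)) => i; rewrite -fE; congr F; lia.
Qed.

(** * Plays on the torus as an arena *)

Section Torus.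
Variables m n : nat.
Local Notation G := (cart_prod (cycle_graph m.+1) (cycle_graph n.+1)).
Variable sigma : cop_strategy G.
Hypothesis sigma_legal : cop_legal sigma.
Local Open Scope Z_scope.
Local Notation M := (Z.of_nat m.+1).
Local Notation N := (Z.of_nat n.+1).

Definition tproj (x y : Z) : G := (proj m x, proj n y).

Lemma tproj_legal x y x' y' : Z.abs (x' - x) + Z.abs (y' - y) <= 1 ->
  legal_move (tproj x y) (tproj x' y').
Proof.
move=> xy; have [E|E] : x = x' \/ y = y' by lia.
- have := proj_legal n y y' ltac:(lia); rewrite /legal_move /tproj E => /orP[/eqP->|h].
    by rewrite eqxx.
  by apply/orP; right; apply/orP; left; apply/andP; split; [exact/eqP | exact: h].
- have := proj_legal m x x' ltac:(lia); rewrite /legal_move /tproj E => /orP[/eqP->|h].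
    by rewrite eqxx.
  by apply/orP; right; apply/orP; right; apply/andP; split; [exact/eqP | exact: h].
Qed.

Lemma legal_tproj x y v : legal_move (tproj x y) v ->
  exists e f, Z.abs e + Z.abs f <= 1 /\ v = tproj (x + e) (y + f).
Proof.
move=> leg; have : (exists2 e, Z.abs e <= 1 & v = tproj (x + e) y) \/
    exists2 f, Z.abs f <= 1 & v = tproj x (y + f).
  case/orP: leg => [/eqP<-|]; first by left; exists 0; rewrite ?Z.add_0_r.
  case: v => v1 v2 /orP[/andP[/eqP /= <- h]|/andP[/eqP /= <- h]]; [right | left].
    have [|f f1 ->] := @legal_proj n y v2; first by apply/orP; right.
    by exists f.
  have [|f f1 ->] := @legal_proj m x v1; first by apply/orP; right.
  by exists f.
case=> [[e e1 ->]|[f f1 ->]]; [exists e, 0 | exists 0, f];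
  by rewrite Z.add_0_r; split=> //; lia.
Qed.

Lemma circ0_proj k x y : circ (Z.of_nat k.+1) (x - y) = 0 <-> proj k x = proj k y.
Proof.
split=> [|/proj_eq[i xy]].
  rewrite /circ => h; apply/proj_eq; exists ((x - y) / Z.of_nat k.+1).
  have := Z_div_mod_eq_full (x - y) (Z.of_nat k.+1).
  by have := Z.mod_pos_bound (x - y) (Z.of_nat k.+1); lia.
have -> : x - y = 0 + i * Z.of_nat k.+1 by lia.
by rewrite circ_addm.
Qed.

Hypotheses (M_gt1 : 1 < M) (N_gt1 : 1 < N).

Lemma tproj_neq x y x' y' : tproj x y != tproj x' y' <->
  1 <= circ M (x - x') + circ N (y - y').
Proof.
have [hx hy] := (circ0_proj m x x', circ0_proj n y y').
have := circ_ge0 M M_gt1 (x - x'); have := circ_ge0 N N_gt1 (y - y') => h1 h2.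
split=> [/eqP ne|h]; last first.
  by apply/eqP => -[/hx x0 /hy y0]; rewrite x0 y0 in h; lia.
case: (Z.eq_dec (circ M (x - x')) 0) => [/hx x0|]; last by lia.
case: (Z.eq_dec (circ N (y - y')) 0) => [/hy y0|]; last by lia.
by case: ne; rewrite /tproj x0 y0.
Qed.

Lemma tproj_ex v : exists x y, v = tproj x y.
Proof. by case: v => v1 v2; exists (Z.of_nat v1), (Z.of_nat v2); rewrite /tproj !proj_ord. Qed.

Let d : G * G := (tproj 0 0, tproj 0 0).

(** The cop's coordinates lift his answer to [hist], the robber's lift the last recorded position,
    so the robber is to move. *)
Record tstate := TState {
  hist : history G; hist_live : live G sigma d hist; hist_gt0 : (0 < size hist)%nat;
  copx : Z; copy : Z; robx : Z; roby : Z;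
  copE : sigma hist = tproj copx copy; robE : (last d hist).2 = tproj robx roby }.

Definition thit (s : tstate) x y := tproj x y \in map snd (hist s).

(** The cop's answer changes the distance by at most 1, so distance 2 after the robber's step rules
    out a capture. *)
Lemma tstate_move (s : tstate) u v : Z.abs u + Z.abs v <= 1 ->
  2 <= circ M (copx s - robx s - u) + circ N (copy s - roby s - v) ->
  exists s', [/\ robx s' = robx s + u, roby s' = roby s + v,
    Z.abs (copx s' - copx s) + Z.abs (copy s' - copy s) <= 1 &
    forall x y, thit s x y -> thit s' x y].
Proof.
case: s => h hl h0 X Y x y cE rE; cbn [copx copy robx roby] => uv safe.
set r := tproj (x + u) (y + v).
have : legal_move (sigma h) (sigma (rcons h (sigma h, r))) by exact: sigma_legal.
rewrite {1}cE => /legal_tproj[e [f [ef cE']]].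
have hl' : live G sigma d (rcons h (sigma h, r)).
  apply: live_rcons => //.
  - by rewrite cE; apply/tproj_neq; rewrite !Z.sub_add_distr; lia.
  - rewrite cE'; apply/tproj_neq.
    have -> : X + e - (x + u) = X - x - u + e by lia.
    have -> : Y + f - (y + v) = Y - y - v + f by lia.
    have := circ_lip M M_gt1 (X - x - u) e; have := circ_lip N N_gt1 (Y - y - v) f.
    by lia.
  - by move=> _; rewrite rE; apply: tproj_legal; lia.
have h0' : (0 < size (rcons h (sigma h, r)))%nat by rewrite size_rcons.
have rE' : (last d (rcons h (sigma h, r))).2 = tproj (x + u) (y + v) by rewrite last_rcons.
exists (TState _ hl' h0' _ _ _ _ cE' rE'); split=> //=; first by lia.
by move=> x' y' hx; rewrite /thit map_rcons mem_rcons inE; apply/orP; right.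
Qed.

Lemma tstate_start u v : 2 <= circ M u + circ N v ->
  exists s : tstate, Z.abs (copx s - robx s - u) + Z.abs (copy s - roby s - v) <= 1.
Proof.
move=> safe; have [X [Y cE]] := tproj_ex (sigma [::]).
set r := tproj (X - u) (Y - v).
have [c cE0] : exists c, sigma [:: (sigma [::], r)] = c /\ legal_move (sigma [::]) c.
  by eexists; split; [reflexivity | exact: (sigma_legal [::])].
case: cE0 => cE1; rewrite cE => /legal_tproj[e [f [ef cE2]]].
have hl' : live G sigma d (rcons [::] (sigma [::], r)).
  apply: live_rcons => //.
  - rewrite cE; apply/tproj_neq.
    have -> : X - (X - u) = u by lia.
    have -> : Y - (Y - v) = v by lia.
    by lia.
  - rewrite /= cE1 cE2; apply/tproj_neq.
    have -> : X + e - (X - u) = u + e by lia.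
    have -> : Y + f - (Y - v) = v + f by lia.
    have := circ_lip M M_gt1 u e; have := circ_lip N N_gt1 v f.
    by lia.
rewrite cE2 in cE1.
by exists (TState _ hl' isT _ _ _ _ cE1 erefl) => /=; lia.
Qed.

(** Kept transparent so that [hit] unfolds to [thit] when hits are counted. *)
Definition torus_arena : arena M N.
Proof.
refine (@Arena M N tstate robx roby copx copy thit _ _ _ _ tstate_move tstate_start).
- move=> s x y; rewrite /thit /tproj.
  have -> // : proj m (x + M) = proj m x.
  by apply/proj_eq; exists 1; lia.
- move=> s x y; rewrite /thit /tproj.
  have -> // : proj n (y + N) = proj n y.
  by apply/proj_eq; exists 1; lia.
- case=> h hl h0 X Y x y cE rE; rewrite /thit -rE; cbn [hist].
  by apply: map_f; case: h h0 {hl cE rE} => // a h _; rewrite /= mem_last.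
- case=> h hl h0 X Y x y cE rE; apply/tproj_neq; rewrite -cE -rE.
  have ih : ((size h).-1 < size h)%nat by rewrite prednK.
  have [_ _ + _] := hl _ ih; rewrite prednK // take_size.
  by rewrite nth_last.
Defined.

End Torus.

(** The counting argument goes row by row; exchanging the coordinates gives the bound by columns. *)
Definition swap_arena {m n : Z} (A : arena m n) : arena n m.
Proof.
refine (@Arena n m (state A) (fun s => ry s) (fun s => rx s) (fun s => cy s) (fun s => cx s)
  (fun s x y => hit s y x) _ _ _ _ _ _).
- by move=> s x y; apply: hit_py.
- by move=> s x y; apply: hit_px.
- by move=> s; apply: hit_cur.
- by move=> s; have := apart _ _ _ s; lia.
- move=> s u v uv safe; have [||s' [h1 h2 h3 h4]] := move_ex _ _ _ s v u; try lia.
  by exists s'; split=> // [|x y]; [lia | apply: h4].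
- move=> u v safe; have [|s h] := start_ex _ _ A v u; first lia.
  by exists s; lia.
Defined.

Section TorusDamage.
Variables m n : nat.
Hypotheses (m_ge3 : (3 <= m)%nat) (n_ge3 : (3 <= n)%nat).
Local Notation G := (cart_prod (cycle_graph m.+1) (cycle_graph n.+1)).

Lemma card_torus (sigma : cop_strategy G) (s : tstate m n sigma) :
  zsum (fun y => zsum (fun x => Z.b2z (thit m n sigma s x y)) 0 m.+1) 0 n.+1 =
  Z.of_nat #|[set v in map snd (hist m n sigma s)]|.
Proof.
pose f x y : nat := (proj m (Z.of_nat x), proj n (Z.of_nat y)) \in map snd (hist m n sigma s).
rewrite (zsum_nat _ (fun y => \sum_(x < m.+1) f x y)); last first.
  move=> y; rewrite (zsum_nat _ (fun x => f x y)) // => x.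
  by rewrite /thit /tproj /f !Z.add_0_l; case: (_ \in _).
congr Z.of_nat; rewrite exchange_big pair_big -sum1_card [RHS]big_mkcond /=.
apply: eq_bigr => -[x y] _; rewrite inE /f !proj_ord /=.
by case: (_ \in _).
Qed.

(** Replaying the play recorded in [s] damages every vertex hit there. *)
Lemma dmg_torus_ge B : B <= m.+1 * n.+1 ->
  (forall sigma : cop_strategy G, cop_legal sigma -> exists s : tstate m n sigma,
    (Z.of_nat B <=
     zsum (fun y => zsum (fun x => Z.b2z (thit m n sigma s x y)) 0 m.+1) 0 n.+1)%Z) ->
  B <= dmg G.
Proof.
move=> Bmn h; apply: dmg_ge => [|sigma sL]; first by rewrite card_prod !card_ord.
have [s] := h sigma sL; rewrite card_torus => Bs.
exists (replay G (tproj m n 0 0, tproj m n 0 0) (hist m n sigma s)); first exact: replay_legal.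
apply: leq_trans (damage_replay _ _ _ _ (hist_live m n sigma s)).
by apply/leP; lia.
Qed.

Lemma dmg_torus_rows L : 0 < L -> 2 * L < m.+1 -> L * n.+1 <= dmg G.
Proof.
rewrite mul2n -addnn => L0 Lm; apply: dmg_torus_ge => [|sigma sL].
  by rewrite leq_mul2r; apply: ltnW; apply: leq_ltn_trans (leq_addr L L) Lm.
move/ltP: L0 => L0; move/ltP: Lm; rewrite -plusE => Lm.
move/leP: m_ge3 => m3; move/leP: n_ge3 => n3.
have M1 : (1 < Z.of_nat m.+1)%Z by lia.
have N1 : (1 < Z.of_nat n.+1)%Z by lia.
have [||||s] := many_hits (torus_arena m n sigma sL M1 N1) (Z.of_nat L); try lia.
by rewrite /hits /row_hits !Nat2Z.id => h; exists s; rewrite -multE Nat2Z.inj_mul Z.mul_comm; exact: h.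
Qed.

Lemma dmg_torus_columns L : 0 < L -> 2 * L < n.+1 -> L * m.+1 <= dmg G.
Proof.
rewrite mul2n -addnn => L0 Ln; apply: dmg_torus_ge => [|sigma sL].
  by rewrite mulnC leq_mul2l; apply: ltnW; apply: leq_ltn_trans (leq_addr L L) Ln.
move/ltP: L0 => L0; move/ltP: Ln; rewrite -plusE => Ln.
move/leP: m_ge3 => m3; move/leP: n_ge3 => n3.
have M1 : (1 < Z.of_nat m.+1)%Z by lia.
have N1 : (1 < Z.of_nat n.+1)%Z by lia.
have [||||s] := many_hits (swap_arena (torus_arena m n sigma sL M1 N1)) (Z.of_nat L); try lia.
by rewrite /hits /row_hits !Nat2Z.id zsum_exchange => h; exists s; rewrite -multE Nat2Z.inj_mul Z.mul_comm; exact: h.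
Qed.

End TorusDamage.

Theorem theorem17 (m n : nat) (hm : 4 <= m) (hn : 4 <= n) :
  maxn (dmg (cycle_graph m) * #|cycle_graph n|)
       (dmg (cycle_graph n) * #|cycle_graph m|)
  <= dmg (cart_prod (cycle_graph m) (cycle_graph n)).
Proof.
case: m hm => // m m3; case: n hn => // n n3.
(* For a cycle on [k.+1] vertices, [k./2] is the known damage number; it enters here as an upper
   bound and serves as [L] on the torus. *)
have half k : 3 <= k -> [/\ 0 < k./2, 2 * k./2 < k.+1 & dmg (cycle_graph k.+1) <= k./2].
  move=> k3; split.
  - by rewrite half_gt0; apply: ltnW.
  - by rewrite ltnS mul2n -[leqRHS]odd_double_half leq_addl.
  apply: dmg_cycle; have := odd_double_half k; rewrite -addnn -!plusE.
  by case: (odd k); rewrite [nat_of_bool _]/=; lia.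
have [m0 mm dm] := half m m3; have [n0 nn dn] := half n n3.
rewrite !card_ord geq_max; apply/andP; split.
  by apply: leq_trans (leq_mul dm (leqnn _)) _; apply: dmg_torus_rows.
by apply: leq_trans (leq_mul dn (leqnn _)) _; apply: dmg_torus_columns.
Qed.
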